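(* Let $n\ge2$ and let $\mathcal M=\mathrm{CM}(D_n,X,p)$ be a regular Cayley map with associated power function $\pi$. Then (1) $\mathrm{Ker}(\pi)$ is a dihedral subgroup of $D_n$, i.e. $\mathrm{Ker}(\pi)\cap(D_n\setminus C_n)\neq\emptyset$; and (2) either $\mathcal M$ is the embedding of the octahedron into the sphere and $|\mathrm{Ker}(\pi)|=2$, or $|\mathrm{Ker}(\pi)|\ge4$.
   Context: $D_n=\langle a,b\mid a^n=b^2=baba=1\rangle$ is the dihedral group of order $2n$, $C_n=\langle a\rangle$. For a finite group $G$, a generating subset $X\subseteq G$ with $X=X^{-1}$, $1_G\notin X$, and a cyclic permutation $p$ of $X$, the Cayley map $\mathrm{CM}(G,X,p)$ is the map with underlying Cayley graph $\mathrm{Cay}(G,X)$ (vertices $G$, edges $\{g,gx\}$) and rotation $(g,gx)\mapsto(g,g\,p(x))$; it is regular if its automorphism group (dart permutations commuting with rotation and dart-reversal) is transitive on darts. A skew-morphism of $G$ is a permutation $\psi$ of $G$ fixing $1_G$ with a function $\pi:G\to\{1,\dots,r\}$ ($r$ the order of $\psi$) such that $\psi(gh)=\psi(g)\psi^{\pi(g)}(h)$ for all $g,h$. A Cayley map is regular iff some skew-morphism $\psi$ agrees with $p$ on $X$; this unique $\psi$ and its power function $\pi$ are the associated skew-morphism and power function. $\mathrm{Ker}(\pi)=\{g:\pi(g)=1\}$. *)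

(* Defs.v *)
From HB Require Import structures.
From mathcomp Require Import all_boot all_fingroup all_solvable.

Set Implicit Arguments.
Unset Strict Implicit.
Unset Printing Implicit Defensive.

Local Open Scope group_scope.

(* The whole group on gT is < a, b | a^n = b^2 = baba = 1 >, with a and b the
   distinguished generators: they satisfy the relations and generate, and no
   finite group generated by such a pair is larger. *)
Definition dihedral_presentation (gT : finGroupType) (n : nat) (a b : gT) : Prop :=
  [/\ a ^+ n = 1, b ^+ 2 = 1, b * a * b * a = 1,
      <<[set a; b]>> = [set: gT]
    & [set: gT] \isog Grp (x : y : x ^+ n, y ^+ 2, y * x * y * x)].

(* A permutation of X is encoded as a permutation of gT fixing every element
   outside X. *)
Definition cyclic_perm_of (gT : finGroupType) (X : {set gT}) (p : {perm gT}) : Prop :=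
  perm_on X p /\ {in X, forall x, porbit p x = X}.

Record cayley_map (gT : finGroupType) := CayleyMap {
  cm_set : {set gT};
  cm_perm : {perm gT};
  cm_gen : <<cm_set>> = [set: gT];
  cm_inv : cm_set^-1 = cm_set;
  cm_not1 : 1 \notin cm_set;
  cm_cyclic : cyclic_perm_of cm_set cm_perm
}.

Section CayleyMap.

Variables (gT : finGroupType) (M : cayley_map gT).

Definition cm_adj : rel gT := [rel g h | g^-1 * h \in cm_set M].

(* The dart (g, gx), x in X, is the pair of its initial and terminal vertex. *)
Definition cm_dart := {d : gT * gT | cm_adj d.1 d.2}.

Lemma cm_rot_subproof (d : cm_dart) :
  cm_adj (val d).1 ((val d).1 * cm_perm M ((val d).1^-1 * (val d).2)).
Proof.
case: d => [[g h] gh]; rewrite /cm_adj /= mulKg.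
by case: (cm_cyclic M) => pX _; rewrite perm_closed.
Qed.

Definition cm_rot_fun (d : cm_dart) : cm_dart :=
  exist (fun d : gT * gT => cm_adj d.1 d.2) (_, _) (cm_rot_subproof d).

Lemma cm_rot_inj : injective cm_rot_fun.
Proof.
move=> [[g h] gh] [[g' h'] gh'] /(congr1 val) /= [eqg eqh].
apply: val_inj; rewrite /= -eqg in eqh *.
by move: eqh => /mulgI/perm_inj/mulgI ->.
Qed.

Definition cm_rot : {perm cm_dart} := perm cm_rot_inj.

Lemma cm_rev_subproof (d : cm_dart) : cm_adj (val d).2 (val d).1.
Proof.
case: d => [[g h] gh].
by rewrite /cm_adj /= -(cm_inv M) inE invMg invgK.
Qed.

Definition cm_rev_fun (d : cm_dart) : cm_dart :=
  exist (fun d : gT * gT => cm_adj d.1 d.2) (_, _) (cm_rev_subproof d).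

Lemma cm_rev_inj : injective cm_rev_fun.
Proof.
move=> [[g h] gh] [[g' h'] gh'] /(congr1 val) /= [eqh eqg].
by apply: val_inj; rewrite /= eqh eqg.
Qed.

Definition cm_rev : {perm cm_dart} := perm cm_rev_inj.

Definition cm_aut : {group {perm cm_dart}} := 'C([set cm_rot; cm_rev])%G.

Definition cm_regular : Prop := [transitive cm_aut, on [set: cm_dart] | 'P].

(* The supporting surface is orientable, and connected because X generates, so
   it is the sphere iff V - E + F = 2. Vertices, edges and faces are the orbits
   of the rotation, of the dart reversal and of their product. *)
Definition cm_spherical : Prop :=
  (#|porbits cm_rot| + #|porbits (cm_rev * cm_rot)| = #|porbits cm_rev| + 2)%N.

(* The vertices of the octahedron are the unit vectors +e_i, -e_i, i < 3;
   two of them are adjacent iff they lie on different axes. *)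
Definition octahedron_adj : rel ('I_3 * bool) := [rel u v | u.1 != v.1].

Definition cm_spherical_octahedron : Prop :=
  cm_spherical /\
  exists2 f : gT -> 'I_3 * bool, bijective f &
    forall g h, cm_adj g h = octahedron_adj (f g) (f h).

End CayleyMap.

Definition skew_morphism (gT : finGroupType) (psi : {perm gT}) (pw : gT -> nat) : Prop :=
  [/\ psi 1 = 1,
      forall g, (1 <= pw g <= #[psi])%N
    & forall g h, psi (g * h) = psi g * (psi ^+ pw g) h].

Definition associated_skew_morphism (gT : finGroupType) (M : cayley_map gT)
    (psi : {perm gT}) (pw : gT -> nat) : Prop :=
  skew_morphism psi pw /\ {in cm_set M, psi =1 cm_perm M}.

Definition power_ker (gT : finGroupType) (pw : gT -> nat) : {set gT} :=
  [set g | pw g == 1%N].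

(* Main.v *)
Require Import Defs.
From mathcomp Require Import all_boot all_fingroup all_solvable zify.

(* Let psi be a skew-morphism of D_n with power function pi and kernel K, such
   that an orbit X of psi generates D_n. The permutation psi ^+ pi g depends
   exactly on the coset K g and is never 1, so #|D_n : K| < #[psi]. The fixed
   points of an element of <[psi]> form a subgroup, hence <[psi]> is semiregular
   on X and #[psi] = #|X|. If x and psi x are both involutions of X, then x lies
   in K.

   Suppose first that K = {1, k} with k a reflection. For an involution x of X,
   the map c |-> (psi ^+ pi c) x sends the rotations c that do not conjugate k to
   x injectively to noninvolutions of X. Counting shows that all involutions of X
   are conjugate to k and that X contains every rotation of order at least 3. As
   #|X| > n, every element outside X is fixed by a nontrivial element of <[psi]>,
   so that only few reflections lie outside X; this forces n = 3 and #|X| = 4,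
   and the map is the octahedron.

   Suppose next that K contains only rotations. Then K is invariant under psi and
   normal, and psi induces a skew-morphism of D_n / K. The elements of <[psi]>
   that fix every coset of K are automorphisms, so for a reflection g whose coset
   lies in the kernel of the induced skew-morphism, psi ^+ (pi g - 1) is the
   unique involution of <[psi]>. Hence that kernel contains at most one
   reflection. By induction it contains one, so it has order 2 and the quotient
   is the octahedron. Then two consecutive elements of X are reflections, and the
   first of them lies in K, a contradiction. *)

Set Implicit Arguments.
Unset Strict Implicit.
Unset Printing Implicit Defensive.

Local Open Scope group_scope.

Section CyclicGroups.

Variable gT : finGroupType.
Implicit Types (G H : {group gT}) (x y : gT).

Lemma cycle_ind x (P : gT -> Prop) :
  P 1 -> (forall y, y \in <[x]> -> P y -> P (y * x)) ->
  forall y, y \in <[x]> -> P y.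
Proof.
move=> P1 PM y /cycleP[i ->]; elim: i => [|i IHi]; first by rewrite expg0.
by rewrite expgSr; apply: PM => //; apply: mem_cycle.
Qed.

Lemma mem_cycle3g x y : #[x] = 3 -> (y \in <[x]>) = [|| y == 1, y == x | y == x^-1].
Proof.
move=> ox; have x_neq1 : x != 1 by rewrite -order_gt1 ox.
suffices /setP/(_ y) : [set 1; x; x^-1] = <[x]> by rewrite !inE -orbA.
apply/eqP; rewrite eqEcard -orderE ox; apply/andP; split.
  by apply/subsetP=> z; rewrite !inE -orbA => /or3P[]/eqP->;
    rewrite ?groupV ?cycle_id.
rewrite setUC cardsU1 cards2 !inE negb_or eq_invg1 [1 == x]eq_sym x_neq1.
by rewrite eq_invg_mul -expg2 -order_dvdn ox.
Qed.

Lemma cyclic_involution_unique G x y :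
  cyclic G -> x \in G -> y \in G -> #[x] = 2 -> #[y] = 2 -> x = y.
Proof.
move=> cG Gx Gy ox oy.
have /eqP eq_xy : <[x]> == <[y]>.
  by rewrite (eq_subG_cyclic cG) ?cycle_subG // -!orderE ox oy.
have: x \in <[y]> by rewrite -eq_xy cycle_id.
by rewrite cycle2g // !inE -order_eq1 ox => /eqP.
Qed.

Lemma dvdn_cyclic_index G H m :
  cyclic G -> (forall x, x \in G -> x ^+ m \in H) -> #|G : H| %| m.
Proof.
move=> cG expG_H; rewrite -indexgI.
have nGH : G \subset 'N(G :&: H).
  by rewrite sub_abelian_norm ?cyclic_abelian // subsetIl.
rewrite -card_quotient // -exponent_cyclic ?quotient_cyclic //.
apply/exponentP=> _ /morphimP[x Nx Gx ->].
by rewrite -morphX //= coset_id // inE groupX // expG_H.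
Qed.

End CyclicGroups.

Section FixedPoints.

Variable T : finType.
Implicit Types (x : T) (s w : {perm T}).

Lemma afix_permP s x : reflect (s x = x) (x \in 'Fix_'P[s]).
Proof. by apply: (iffP afix1P). Qed.

Lemma afix_perm_cycle s w x : w \in <[s]> -> x \in 'Fix_'P[s] -> w x = x.
Proof. by move=> sw; rewrite -afix_cycle => /afixP/(_ w sw). Qed.

End FixedPoints.

(** * Cocycles of permutations of a group *)

Section Cocycle.

Variable gT : finGroupType.
Implicit Types (g h : gT) (s w : {perm gT}) (H : {group gT}).

Definition lmul_perm g : {perm gT} := perm (mulgI g).

(* If s is a skew-morphism with power function pi, then cocycle s g is the
   permutation s ^+ pi g; as a permutation it is well defined, whereas pi g is
   only determined modulo the order of s. *)
Definition cocycle s g : {perm gT} := lmul_perm g * s * (lmul_perm (s g))^-1.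

Lemma lmul_permE g h : lmul_perm g h = g * h.
Proof. exact: permE. Qed.

Lemma cocycleE s g h : cocycle s g h = (s g)^-1 * s (g * h).
Proof.
rewrite /cocycle !permM lmul_permE; apply: (@perm_inj _ (lmul_perm (s g))).
by rewrite permKV lmul_permE mulKVg.
Qed.

Lemma perm_mulg s g h : s (g * h) = s g * cocycle s g h.
Proof. by rewrite cocycleE mulKVg. Qed.

Lemma cocycle_permM s w g : cocycle (s * w) g = cocycle s g * cocycle w (s g).
Proof. by rewrite /cocycle permM !mulgA mulgKV. Qed.

(* cocycle is a right action of the group on its permutations fixing 1, and
   skew_ker s below is the stabiliser of s. *)
Lemma cocycleM s g h : cocycle s (g * h) = cocycle (cocycle s g) h.
Proof. by apply/permP=> u; rewrite !cocycleE invMg invgK !mulgA mulgK. Qed.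

Lemma cocycleg1 s : s 1 = 1 -> cocycle s 1 = s.
Proof. by move=> s1; apply/permP=> u; rewrite cocycleE s1 invg1 !mul1g. Qed.

Lemma cocycle1g g : cocycle 1 g = 1.
Proof. by apply/permP=> u; rewrite cocycleE !perm1 mulKg. Qed.

Lemma cocycle_neq1 s g : s 1 = 1 -> s != 1 -> cocycle s g != 1.
Proof.
move=> s1; apply: contraNneq => cs1.
by rewrite -(cocycleg1 s1) -(mulgV g) cocycleM cs1 cocycle1g.
Qed.

Definition skew_ker s : {set gT} := [set g | cocycle s g == cocycle s 1].

Lemma skew_ker_group_set s : group_set (skew_ker s).
Proof.
apply/group_setP; split=> [|g h]; rewrite !inE // => /eqP sg /eqP sh.
by rewrite cocycleM sg -cocycleM mul1g sh.
Qed.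

Canonical skew_ker_group s := Group (skew_ker_group_set s).

Lemma mem_skew_ker s g : s 1 = 1 -> (g \in skew_ker s) = (cocycle s g == s).
Proof. by move=> s1; rewrite inE cocycleg1. Qed.

Lemma skew_kerP s g : s 1 = 1 ->
  reflect (forall h, s (g * h) = s g * s h) (g \in skew_ker s).
Proof.
move=> s1; rewrite mem_skew_ker //; apply: (iffP eqP) => [sg h | sM].
  by rewrite perm_mulg sg.
by apply/permP=> h; rewrite cocycleE sM mulKg.
Qed.

Lemma cocycle_eq s g h : (cocycle s g == cocycle s h) = (g * h^-1 \in skew_ker s).
Proof.
rewrite inE; apply/eqP/eqP=> eq_gh; first by rewrite cocycleM eq_gh -cocycleM mulgV.
by rewrite -(mulgKV h g) cocycleM eq_gh -cocycleM mul1g.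
Qed.

Lemma cocycle_inj_in H s : skew_ker s :&: H = 1 -> {in H &, injective (cocycle s)}.
Proof.
move=> tiH g h Hg Hh /eqP; rewrite cocycle_eq => Kgh; apply/eqP.
by rewrite eq_mulgV1 -in_set1 -[[set 1]]tiH inE Kgh groupM ?groupV.
Qed.

Lemma card_cocycle_image s : #|cocycle s @: [set: gT]| = #|[set: gT] : skew_ker s|.
Proof.
apply/eqP; rewrite -(eqn_pmul2l (cardG_gt0 (skew_ker s))) Lagrange ?subsetT //.
rewrite mulnC -sum_nat_const -[#|[set: gT]|]sum1_card; apply/eqP.
rewrite (partition_big_imset (cocycle s)) /=; apply: eq_bigr => _ /imsetP[g _ ->].
rewrite sum1dep_card -(card_rcoset (skew_ker s) g); apply: eq_card => h.
by rewrite mem_rcoset -cocycle_eq inE in_setT.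
Qed.

End Cocycle.

(** * Skew-morphisms with a generating orbit *)

Section SkewPerm.

Variable gT : finGroupType.
Implicit Types (g h x y z : gT) (s w psi : {perm gT}) (X : {set gT}).

Definition skew_perm psi : Prop :=
  psi 1 = 1 /\ forall g, cocycle psi g \in <[psi]>.

Definition generating_orbit psi X : Prop :=
  <<X>> = [set: gT] /\ X \in porbits psi.

Variable psi : {perm gT}.
Hypothesis psi_skew : skew_perm psi.

Lemma cycle_permC s w x : s \in <[psi]> -> w \in <[psi]> -> s (w x) = w (s x).
Proof.
by move=> psi_s psi_w; rewrite -!permM (centsP (cycle_abelian psi) s psi_s w psi_w).
Qed.

Lemma skew_perm1 s : s \in <[psi]> -> s 1 = 1.
Proof.
by elim/cycle_ind=> [|w _ IHw]; rewrite ?perm1 // permM IHw; case: psi_skew.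
Qed.

Lemma cocycle_cycle s g : s \in <[psi]> -> cocycle s g \in <[psi]>.
Proof.
elim/cycle_ind=> [|w _ IHw]; first by rewrite cocycle1g group1.
by rewrite cocycle_permM groupM //; case: psi_skew.
Qed.

(* At a fixed point g of s, cocycle s g is conjugate to s, so it is an element
   of the cyclic group <[psi]> of the same order as s, that is, a power of s. *)
Lemma afix_group_set s : s \in <[psi]> -> group_set 'Fix_'P[s].
Proof.
move=> psi_s; apply/group_setP; split=> [|g h Fg Fh].
  exact/afix_permP/skew_perm1.
have sg := afix_permP _ _ Fg.
have eq_cs : <[cocycle s g]> = <[s]>.
  apply/eqP; rewrite (eq_subG_cyclic (cycle_cyclic psi)) ?cycle_subG
    ?cocycle_cycle //.
  have ->: cocycle s g = s ^ (lmul_perm g)^-1.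
    by rewrite /cocycle conjgE invgK mulgA; congr (_ * (lmul_perm _)^-1).
  by rewrite -!orderE orderJ.
have cs : cocycle s g \in <[s]> by rewrite -eq_cs cycle_id.
by apply/afix_permP; rewrite perm_mulg sg (afix_perm_cycle cs Fh).
Qed.

Lemma afix_mulg s : s \in <[psi]> ->
  {in 'Fix_'P[s] &, forall g h, g * h \in 'Fix_'P[s]}.
Proof. by case/afix_group_set/group_setP. Qed.

Lemma afix_invariant s w g :
  s \in <[psi]> -> w \in <[psi]> -> g \in 'Fix_'P[s] -> w g \in 'Fix_'P[s].
Proof.
by move=> psi_s psi_w /afix_permP sg; apply/afix_permP; rewrite cycle_permC // sg.
Qed.

Lemma central_fixed_skew_ker z : z \in 'Z([set: gT]) -> psi z = z ->
  z \in skew_ker psi.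
Proof.
have [psi1 cocycle_psi] := psi_skew; move=> /centerP[_ zC] psiz.
apply/skew_kerP=> // h.
have fix_z : z \in 'Fix_'P[psi] by apply/afix_permP.
by rewrite zC ?inE // perm_mulg (afix_perm_cycle (cocycle_psi h)) // psiz zC ?inE.
Qed.

Lemma cocycle_central z g :
  z \in 'Z([set: gT]) -> z \in skew_ker psi -> cocycle psi g z = psi z ^ psi g.
Proof.
have [psi1 _] := psi_skew; move=> /centerP[_ zC] /(skew_kerP _ psi1) psi_zM.
by rewrite cocycleE -zC ?inE // psi_zM conjgE.
Qed.

Lemma central_skew_ker_afix z : z \in 'Z([set: gT]) -> z \in skew_ker psi ->
  psi^-1 z \notin skew_ker psi -> exists2 s, s \in <[psi]>^# & z \in 'Fix_'P[s].
Proof.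
have [psi1 cocycle_psi] := psi_skew; move=> zC Kz.
rewrite mem_skew_ker // => cocycle_neq.
exists (cocycle psi (psi^-1 z) * psi^-1).
  by rewrite in_setD1 -eq_mulgV1 cocycle_neq groupM ?groupV ?cycle_id.
apply/afix_permP; rewrite permM cocycle_central // permKV.
have /centerP[_ z_comm] := zC; rewrite (conjg_fixP _) ?permK //.
by apply/commgP/commute_sym/z_comm; rewrite inE.
Qed.

Lemma afix_conj s z g : z \in 'Z([set: gT]) -> z \in skew_ker psi ->
  s \in <[psi]> -> z \in 'Fix_'P[s] -> psi z ^ g \in 'Fix_'P[s].
Proof.
move=> zC Kz psi_s sz.
by rewrite -(permKV psi g) -cocycle_central // afix_invariant ?cocycle_cycle ?cycle_id.
Qed.

Section InvariantKernel.

Hypothesis ker_inv : {in skew_ker psi, forall k, psi k \in skew_ker psi}.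

Lemma skew_ker_cycle s k : s \in <[psi]> -> k \in skew_ker psi ->
  s k \in skew_ker psi.
Proof.
move=> psi_s Kk; elim/cycle_ind: s / psi_s => [|w _ IHw]; first by rewrite perm1.
by rewrite permM ker_inv.
Qed.

Lemma sub_skew_ker_cycle s : s \in <[psi]> -> skew_ker psi \subset skew_ker s.
Proof.
have [psi1 _] := psi_skew; move=> psi_s; apply/subsetP=> k Kk.
apply/skew_kerP=> [|h]; first exact: skew_perm1.
elim/cycle_ind: s / psi_s => [|w psi_w IHw]; first by rewrite !perm1.
by rewrite !permM IHw (skew_kerP _ psi1 (skew_ker_cycle psi_w Kk)).
Qed.

End InvariantKernel.

Section GeneratingOrbit.

Variable X : {set gT}.
Hypothesis X_orbit : generating_orbit psi X.

Lemma generating_orbitE x : x \in X -> X = porbit psi x.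
Proof.
by case: X_orbit => _ /imsetP[y _ ->]; rewrite -eq_porbit_mem => /eqP.
Qed.

Lemma generating_orbit_neq0 : X != set0.
Proof.
by case: X_orbit => _ /imsetP[y _ ->]; apply/set0Pn; exists y; apply: porbit_id.
Qed.

Lemma generating_orbit_perm s x : s \in <[psi]> -> (s x \in X) = (x \in X).
Proof.
have invX w y : w \in <[psi]> -> y \in X -> w y \in X.
  by case/cycleP=> i -> /generating_orbitE->; apply: mem_porbit.
move=> psi_s; apply/idP/idP=> [Xsx|]; last exact: invX.
by rewrite -(permK s x) invX ?groupV.
Qed.

Lemma generating_orbit_trans x y :
  x \in X -> y \in X -> exists2 s, s \in <[psi]> & y = s x.
Proof.
by move=> /generating_orbitE-> /porbitP[i ->]; exists (psi ^+ i); rewrite ?mem_cycle.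
Qed.

Lemma generating_orbit_semiregular s x : s \in <[psi]> -> x \in X -> s x = x -> s = 1.
Proof.
move=> psi_s Xx sx; have [X_gen _] := X_orbit.
have: <<X>> \subset Group (afix_group_set psi_s).
  rewrite gen_subG; apply/subsetP=> y Xy;
    have [w psi_w ->] := generating_orbit_trans Xx Xy.
  by apply: afix_invariant => //; apply/afix_permP.
rewrite X_gen => /subsetP fixT; apply/permP=> g; rewrite perm1.
by have /afix_permP := fixT g (in_setT g).
Qed.

Lemma generating_orbit_inj x : x \in X -> {in <[psi]> &, injective (fun s => s x)}.
Proof.
move=> Xx s w psi_s psi_w eq_sw; apply/eqP; rewrite eq_mulgV1; apply/eqP.
apply: (generating_orbit_semiregular _ Xx); first by rewrite groupM ?groupV.
by rewrite permM eq_sw permK.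
Qed.

Lemma afix_generating_orbit s : s \in <[psi]>^# -> [disjoint 'Fix_'P[s] & X].
Proof.
case/setD1P=> s_neq1 psi_s; apply/pred0P=> x /=.
apply/negP=> /andP[/afix_permP sx Xx].
by rewrite (generating_orbit_semiregular psi_s Xx) ?eqxx in s_neq1.
Qed.

Lemma card_generating_orbit : #|X| = #[psi].
Proof.
have [x Xx] := set0Pn _ generating_orbit_neq0.
rewrite orderE -(card_in_imset (generating_orbit_inj Xx)); apply: eq_card => y.
apply/idP/imsetP => [Xy | [s psi_s ->]]; last by rewrite generating_orbit_perm.
by have [s] := generating_orbit_trans Xx Xy; exists s.
Qed.

Lemma generating_orbit_free x i : x \in X -> (0 < i < #|X|)%N -> (psi ^+ i) x != x.
Proof.
move=> Xx /andP[i_gt0 lt_iX]; apply/eqP.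
move/(generating_orbit_semiregular (mem_cycle psi i) Xx)/eqP; rewrite -order_dvdn.
by rewrite -card_generating_orbit => /(dvdn_leq i_gt0); rewrite leqNgt lt_iX.
Qed.

Lemma conj_involution_skew_ker s x g : s \in <[psi]> -> x \in X -> x ^+ 2 = 1 ->
  cocycle s g x ^+ 2 = 1 -> x ^ g^-1 \in skew_ker s.
Proof.
move=> psi_s Xx xx cxx; rewrite conjgE invgK mulgA -cocycle_eq; apply/eqP.
apply: (generating_orbit_inj Xx); rewrite ?cocycle_cycle //.
apply: (mulgI (cocycle s g x)).
by rewrite cocycleM -perm_mulg -!expg2 xx cxx skew_perm1 ?cocycle_cycle.
Qed.

Lemma consecutive_involutions s x : s \in <[psi]> ->
  x \in X -> x ^+ 2 = 1 -> s x ^+ 2 = 1 -> x \in skew_ker s.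
Proof.
move=> psi_s Xx xx sxx; rewrite -[x]conjg1 -invg1 conj_involution_skew_ker //.
by rewrite cocycleg1 ?skew_perm1.
Qed.

(* As w * s = s * w for w in <[psi]>, comparing the cocycles of both sides at x
   gives cocycle s (w x) = s. *)
Lemma skew_ker_coset_fixing s x :
  {in skew_ker psi, forall k, psi k \in skew_ker psi} ->
  s \in <[psi]> -> (forall g, s g * g^-1 \in skew_ker psi) ->
  x \in X -> x \in skew_ker s -> skew_ker s = [set: gT].
Proof.
move=> ker_inv psi_s fix_coset Xx; have s1 := skew_perm1 psi_s.
have cocycle_fix w g : w \in <[psi]> -> cocycle w (s g) = cocycle w g.
  move=> psi_w; apply/eqP; rewrite cocycle_eq.
  exact: (subsetP (sub_skew_ker_cycle ker_inv psi_w)).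
rewrite mem_skew_ker // => /eqP cocycle_x; have [X_gen _] := X_orbit.
apply/eqP; rewrite -subTset -X_gen gen_subG; apply/subsetP=> y Xy.
have [w psi_w ->] := generating_orbit_trans Xx Xy; rewrite mem_skew_ker //; apply/eqP.
apply: (mulgI (cocycle w x)); rewrite -cocycle_permM.
have comm_psi v : v \in <[psi]> -> v * s = s * v.
  by move=> psi_v; apply: (centsP (cycle_abelian psi)).
by rewrite comm_psi // cocycle_permM cocycle_x cocycle_fix // comm_psi ?cocycle_cycle.
Qed.

Lemma index_skew_ker_lt : psi != 1 -> (#|[set: gT] : skew_ker psi| < #|X|)%N.
Proof.
have [psi1 cocycle_psi] := psi_skew; move=> psi_neq1.
rewrite -card_cocycle_image card_generating_orbit orderE [ltnRHS](cardsD1 1) group1.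
apply: subset_leq_card; apply/subsetP=> _ /imsetP[g _ ->].
by rewrite in_setD1 cocycle_neq1 ?cocycle_psi.
Qed.

(* The order of psi is #|X|, and the orbit of y, being disjoint from X, is
   shorter. *)
Lemma afix_outside_orbit y : (#|gT| < #|X|.*2)%N -> y \notin X ->
  exists2 s, s \in <[psi]>^# & y \in 'Fix_'P[s].
Proof.
move=> ltX Xy; exists (psi ^+ #|porbit psi y|); last first.
  by apply/afix_permP; rewrite permX iter_porbit.
rewrite in_setD1 mem_cycle andbT -order_dvdn -card_generating_orbit.
apply: contraL ltX => /dvdn_leq; rewrite lt0n card_porbit_neq0 => /(_ isT) leX.
rewrite -leqNgt -addnn -cardsT -(cardsID X [set: gT]) setTI leq_add2l.
apply: leq_trans leX (subset_leq_card _); apply/subsetP=> _ /porbitP[i ->].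
by rewrite !inE generating_orbit_perm ?mem_cycle ?Xy.
Qed.

(* If the conclusion failed, the unique involution s of <[psi]> would multiply c
   and c ^+ 2 by k, so cocycle s c would fix c and be trivial, and then
   s 1 = s (c * c^-1) = k. *)
Lemma fixed_skew_ker_involution k c : k \in skew_ker psi -> #[k] = 2 -> psi k = k ->
  ~~ [&& c \in X, k * c \in X, c ^+ 2 \in X & k * c ^+ 2 \in X].
Proof.
have [psi1 _] := psi_skew; move=> /(skew_kerP _ psi1) psi_kM ok psik.
have kk : k * k = 1 by rewrite -expg2 -ok expg_order.
have cycle_kM s x : s \in <[psi]> -> s (k * x) = k * s x.
  by elim/cycle_ind=> [|w _ IHw]; rewrite ?perm1 // !permM IHw psi_kM psik.
have mul_k x : x \in X -> k * x \in X ->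
    exists s, [/\ s \in <[psi]>, s x = k * x & #[s] = 2].
  move=> Xx Xkx; have [s psi_s def_kx] := generating_orbit_trans Xx Xkx.
  exists s; split=> //; apply: nt_prime_order => //.
    apply: (generating_orbit_semiregular _ Xx); first by rewrite groupX.
    by rewrite expg2 permM -def_kx cycle_kM // -def_kx mulgA kk mul1g.
  apply/eqP=> s1; move: def_kx; rewrite s1 perm1 -{2}[x]mul1g => /mulIg k1.
  by rewrite k1 order1 in ok.
apply/and4P=> -[Xc Xkc Xcc Xkcc].
have [s [psi_s sc os]] := mul_k c Xc Xkc; have [w [psi_w wcc ow]] := mul_k _ Xcc Xkcc.
have scc : s (c ^+ 2) = k * c ^+ 2.
  by rewrite (cyclic_involution_unique (cycle_cyclic psi) psi_s psi_w).
have cocycle1 : cocycle s c = 1.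
  apply: (generating_orbit_semiregular (cocycle_cycle c psi_s) Xc).
  by apply: (mulgI (k * c)); rewrite -{1}sc -perm_mulg scc mulgA.
have:= perm_mulg s c c^-1; rewrite cocycle1 perm1 sc mulgK mulgV (skew_perm1 psi_s).
by move=> k1; rewrite -k1 order1 in ok.
Qed.

End GeneratingOrbit.

End SkewPerm.

(** * Dihedral groups *)

Section Dihedral.

Variable gT : finGroupType.
Implicit Types (x y k z c : gT) (C F : {group gT}).

Definition dihedral_rotations C : Prop :=
  [/\ cyclic C, #|[set: gT] : C| = 2 & forall x, x \notin C -> x ^+ 2 = 1].

Variable C : {group gT}.
Hypothesis dihC : dihedral_rotations C.

Lemma card_dihedral_rotations : #|gT| = #|C|.*2.
Proof. by case: dihC => _ iC _; rewrite -cardsT -(Lagrange (subsetT C)) iC muln2. Qed.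

Lemma card_reflections : #|~: C| = #|C|.
Proof. by rewrite cardsCs setCK card_dihedral_rotations -addnn addnK. Qed.

Lemma reflection_sqr x : x \notin C -> x ^+ 2 = 1.
Proof. by case: dihC => _ _; apply. Qed.

Lemma reflection_neq1 x : x \notin C -> x != 1.
Proof. by apply: contraNneq => ->; apply: group1. Qed.

Lemma order_reflection x : x \notin C -> #[x] = 2.
Proof.
by move=> Cx; rewrite (nt_prime_order _ (reflection_sqr Cx)) ?reflection_neq1.
Qed.

Lemma reflection_inv x : x \notin C -> x^-1 = x.
Proof. by move=> /reflection_sqr xx; apply/eqP; rewrite eq_invg_mul -expg2 xx. Qed.

Lemma conj_rotation x c : x \notin C -> c \in C -> c ^ x = c^-1.
Proof.
move=> Cx Cc; have Ccx : c * x \notin C by rewrite groupMl.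
rewrite conjgE -(reflection_inv Ccx) invMg mulgA (reflection_inv Cx) -expg2.
by rewrite reflection_sqr ?mul1g.
Qed.

Lemma conj_reflection x c : x \notin C -> c \in C -> x ^ c = x * c ^+ 2.
Proof.
move=> Cx Cc; have xx : x * x = 1 := reflection_sqr Cx.
rewrite conjgE -(conj_rotation Cx Cc) conjgE (reflection_inv Cx).
by rewrite -!mulgA (mulgA x x) xx mul1g.
Qed.

Lemma mul_reflections x y : x \notin C -> y \notin C -> x * y \in C.
Proof.
case: dihC => _ iC _ Cx Cy.
have: x \in C :* y^-1 by rewrite (rcoset_index2 (subsetT C) iC) !inE ?groupV ?Cx ?Cy.
by rewrite mem_rcoset invgK.
Qed.

Lemma central_rotation c : c \in C -> c ^+ 2 = 1 -> c \in 'Z([set: gT]).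
Proof.
case: dihC => cycC _ _ Cc cc; apply/centerP; split=> [|g _]; first exact: in_setT.
have [Cg|Cg] := boolP (g \in C); first exact: (centsP (cyclic_abelian cycC)).
apply/commgP/conjg_fixP; rewrite conj_rotation //.
by apply/eqP; rewrite eq_invg_mul -expg2 cc.
Qed.

Lemma cent1_reflection k : k \notin C -> 'C_C[k] = 'Ldiv_2(C).
Proof.
move=> Ck; apply/setP=> c.
apply/subcent1P/LdivP => [[Cc /commute_sym/commgP/conjg_fixP]|[Cc cc]].
  by rewrite conj_rotation // => /eqP; rewrite eq_invg_mul -expg2 => /eqP.
by split=> //; have /centerP[_ cC] := central_rotation Cc cc; apply/esym/cC/in_setT.
Qed.

Lemma dvdn_card_cent1_reflection k : k \notin C -> #|'C_C[k]| %| 2.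
Proof.
move=> Ck; case: dihC => cycC _ _; rewrite -exponent_cyclic; last first.
  exact: cyclicS (subsetIl _ _) cycC.
by apply/exponentP=> c /=; rewrite cent1_reflection // => /LdivP[].
Qed.

Lemma odd_cent1_reflection k : k \notin C -> 'C_C[k] = 1 -> odd #|C|.
Proof.
move=> Ck Ck1; apply: contraT; rewrite -dvdn2 => /(Cauchy (isT : prime 2))[z Cz oz].
have: z \in 'C_C[k].
  by rewrite cent1_reflection //; apply/LdivP; rewrite -oz expg_order.
by rewrite Ck1 => /set1P z1; rewrite z1 order1 in oz.
Qed.

(* A subgroup containing t and its conjugates t * c ^+ 2 contains all squares of
   rotations, hence at least half of the rotations and as many reflections. *)
Lemma card_conj_closed F t :
  t \notin C -> t \in F -> (forall c, c \in C -> t ^ c \in F) -> (#|C| <= #|F|)%N.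
Proof.
move=> Ct Ft FtC; have iCF : (#|C : F| <= 2)%N.
  case: dihC => cycC _ _; apply/dvdn_leq/dvdn_cyclic_index => // c Cc.
  by rewrite -(groupMl _ Ft) -conj_reflection ?FtC.
rewrite -(LagrangeI C F) -(LagrangeI F C) setIC; apply: leq_mul => //.
by apply: leq_trans iCF _; rewrite indexg_gt1; apply/subsetPn; exists t.
Qed.

End Dihedral.

(** * Skew-morphisms of dihedral groups *)

(* With k an involution inverting an element u of order 3, this is the rotation
   of an embedding of the octahedron in the sphere. *)
Definition octahedral_cycle (gT : finGroupType) (psi : {perm gT}) (X : {set gT})
    (k u : gT) : Prop :=
  [/\ X = [set k; k * u^-1; u; u^-1], psi k = k * u^-1, psi (k * u^-1) = u,
      psi u = u^-1 & psi u^-1 = k].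

Section DihedralOrbit.

Variables (gT : finGroupType) (C : {group gT}) (psi : {perm gT}) (X : {set gT}).
Implicit Types (g x y k v z c : gT) (s w : {perm gT}).
Hypothesis dihC : dihedral_rotations C.
Hypothesis C_gt1 : (1 < #|C|)%N.
Hypothesis psi_skew : skew_perm psi.
Hypothesis X_orbit : generating_orbit psi X.

Let psi1 : psi 1 = 1. Proof. by case: psi_skew. Qed.
Let psi_cycle : psi \in <[psi]>. Proof. exact: cycle_id. Qed.
Let cocycle_in g : cocycle psi g \in <[psi]>. Proof. by case: psi_skew. Qed.

Lemma exists_orbit_reflection : exists2 x, x \in X & x \notin C.
Proof.
apply/subsetPn; rewrite -gen_subG; have [-> _] := X_orbit.
by case: dihC => _ iC _; rewrite -indexg_gt1 iC.
Qed.

Lemma generating_orbit_neq1 x : x \in X -> x != 1.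
Proof.
have [y Xy Cy] := exists_orbit_reflection; move=> Xx; apply: contraNneq Cy => x1.
by have [s psi_s ->] := generating_orbit_trans X_orbit Xx Xy;
  rewrite x1 (skew_perm1 psi_skew).
Qed.

Lemma skew_perm_neq1 : psi != 1.
Proof.
have [x Xx Cx] := exists_orbit_reflection; apply: contraTneq C_gt1 => psi_id.
rewrite -leqNgt.
have: [set: gT] \subset <[x]>.
  have [<- _] := X_orbit; rewrite gen_subG; apply/subsetP=> y.
  move=> /(generating_orbit_trans X_orbit Xx)[s].
  rewrite psi_id cycle1 => /set1P-> ->.
  by rewrite perm1 cycle_id.
move/subset_leq_card; rewrite -orderE (order_reflection dihC Cx) cardsT.
by rewrite (card_dihedral_rotations dihC) -[2]/(1.*2) leq_double.
Qed.

Lemma index_skew_ker_lt_orbit : (#|[set: gT] : skew_ker psi| < #|X|)%N.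
Proof. exact: index_skew_ker_lt skew_perm_neq1. Qed.

Section TwoElementKernel.

Variable k : gT.
Hypothesis Ck : k \notin C.
Hypothesis ker_k : skew_ker psi = [set 1; k].

Let ker_k_id : k \in skew_ker psi. Proof. by rewrite ker_k !inE eqxx orbT. Qed.
Let kk : k ^+ 2 = 1. Proof. exact: (reflection_sqr dihC Ck). Qed.

Lemma skew_ker_rotations : skew_ker psi :&: C = 1.
Proof.
rewrite ker_k; apply/setP=> c; rewrite !inE; apply/andP/eqP=> [[/pred2P[]->//]|->].
  by rewrite (negPf Ck).
by rewrite eqxx.
Qed.

Lemma card_rotations_lt_orbit : (#|C| < #|X|)%N.
Proof.
apply: leq_ltn_trans index_skew_ker_lt_orbit.
rewrite -card_cocycle_image -(card_in_imset (cocycle_inj_in skew_ker_rotations)).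
exact/subset_leq_card/imsetS/subsetT.
Qed.

Lemma conj_ker_eq_involution x g : x \in X -> x ^+ 2 = 1 ->
  cocycle psi g x ^+ 2 = 1 -> k ^ g = x.
Proof.
move=> Xx xx /(conj_involution_skew_ker psi_skew X_orbit psi_cycle Xx xx).
rewrite ker_k => /set2P[/eqP|<-]; last by rewrite conjgKV.
by rewrite conjg_eq1 (negPf (generating_orbit_neq1 Xx)).
Qed.

Lemma orbit_noninvolutions_sub : X :\: 'Ldiv_2() \subset C :\: 'C_C[k].
Proof.
apply/subsetP=> y /setDP[_ yy]; rewrite (cent1_reflection dihC Ck) !inE in yy *.
rewrite negb_and yy orbT; apply: contraR yy => /(reflection_sqr dihC)->.
by rewrite eqxx.
Qed.

Definition cocycle_images x : {set gT} :=
  [set cocycle psi c x | c in C :\: amove 'J C k x].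

Lemma cocycle_noninvolutions_sub x : x \in X -> x ^+ 2 = 1 ->
  cocycle_images x \subset X :\: 'Ldiv_2().
Proof.
move=> Xx xx; apply/subsetP=> _ /imsetP[c /setDP[Cc kc] ->].
rewrite !inE (generating_orbit_perm X_orbit) // Xx andbT.
by apply: contra kc => /eqP/(conj_ker_eq_involution Xx xx) kc; rewrite inE Cc /= kc.
Qed.

Lemma card_cocycle_noninvolutions x : x \in X ->
  #|cocycle_images x| = #|C :\: amove 'J C k x|.
Proof.
move=> Xx; apply: card_in_imset => c d /setDP[Cc _] /setDP[Cd _] eq_cd.
apply: (cocycle_inj_in skew_ker_rotations) => //.
exact: (generating_orbit_inj psi_skew X_orbit Xx).
Qed.

Lemma orbit_involution_conj x : x \in X -> x ^+ 2 = 1 -> x \in k ^: C.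
Proof.
move=> Xx xx; apply: contraT => not_conj.
have amove0 : amove 'J C k x = set0.
  apply/setP=> c; rewrite !inE; apply/andP=> -[Cc /eqP kc].
  by case/imsetP: not_conj; exists c.
have sub_cocycle := cocycle_noninvolutions_sub Xx xx.
have := subset_leq_card (subset_trans sub_cocycle orbit_noninvolutions_sub).
rewrite card_cocycle_noninvolutions // amove0 setD0 cardsD (setIidPr (subsetIl _ _)).
by rewrite leqNgt ltn_subrL !cardG_gt0.
Qed.

Lemma cocycle_noninvolutions x : x \in X -> x ^+ 2 = 1 ->
  cocycle_images x = X :\: 'Ldiv_2() /\ X :\: 'Ldiv_2() = C :\: 'C_C[k].
Proof.
move=> Xx xx; have /imsetP[a Ca def_x] := orbit_involution_conj Xx xx.
have card_amove : #|amove 'J C k x| = #|'C_C[k]|.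
  by rewrite def_x (amove_act _ k (subsetT C) Ca) card_rcoset astab1J.
have sub_amove : amove 'J C k x \subset C.
  by apply/subsetP=> c; rewrite inE => /andP[].
have sub_cocycle := cocycle_noninvolutions_sub Xx xx.
have card_cocycle : #|cocycle_images x| = #|C :\: 'C_C[k]|.
  rewrite card_cocycle_noninvolutions // !cardsD (setIidPr sub_amove) card_amove.
  by rewrite (setIidPr (subsetIl _ _)).
have eq_noninv : X :\: 'Ldiv_2() = C :\: 'C_C[k].
  by apply/eqP; rewrite eqEcard orbit_noninvolutions_sub -card_cocycle
    subset_leq_card.
by split=> //; apply/eqP; rewrite eqEcard sub_cocycle eq_noninv card_cocycle leqnn.
Qed.

Lemma mem_orbit_rotation c : c \in C -> (c \in X) = (c \notin 'C_C[k]).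
Proof.
move=> Cc; apply/idP/idP=> [Xc | cent1_c].
  rewrite (cent1_reflection dihC Ck) inE Cc inE; apply: contraTN Cc => /eqP cc.
  by have /imsetP[d Cd ->] := orbit_involution_conj Xc cc; rewrite groupJr.
have [x Xx /(reflection_sqr dihC) xx] := exists_orbit_reflection.
have: c \in X :\: 'Ldiv_2() by rewrite (cocycle_noninvolutions Xx xx).2 inE cent1_c.
by case/setDP.
Qed.

Lemma card_orbit_reflections : (#|X| + #|'C_C[k]| = #|C| + #|X :\: C|)%N.
Proof.
have ->: #|X| = (#|C :\: 'C_C[k]| + #|X :\: C|)%N.
  rewrite -(cardsID C X); congr (_ + _)%N; apply: eq_card => c.
  by rewrite in_setI in_setD; case Cc: (c \in C);
    rewrite ?andbF // mem_orbit_rotation.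
by rewrite -(cardsID 'C_C[k] C) (setIidPr (subsetIl _ _)) addnAC
  [(#|_ :\: _| + _)%N]addnC.
Qed.

Lemma card_orbit_reflections_cent1 : (#|X :\: C| * #|'C_C[k]| <= #|C|)%N.
Proof.
rewrite -(Lagrange (subsetIl C 'C[k])) mulnC leq_mul2l index_cent1 orbC.
apply/orP; left; apply/subset_leq_card/subsetP=> x /setDP[Xx /(reflection_sqr dihC)].
exact: orbit_involution_conj.
Qed.

Lemma afix_rotations s : s \in <[psi]>^# -> 'Fix_'P[s] :&: C \subset 'C_C[k].
Proof.
move=> nt_s; apply/subsetP=> c /setIP[sc Cc]; apply: contraLR sc => cent1_c.
by rewrite (disjointFl (afix_generating_orbit psi_skew X_orbit nt_s))
  ?mem_orbit_rotation.
Qed.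

Lemma afix_reflection_unique s x y :
  s \in <[psi]>^# -> 'Fix_'P[s] :&: 'C_C[k] \subset [1] ->
  x \in 'Fix_'P[s] -> y \in 'Fix_'P[s] -> x \notin C -> y \notin C -> x = y.
Proof.
move=> nt_s tiFC sx sy Cx Cy; have /setD1P[_ psi_s] := nt_s.
have Fxy : x * y \in 'Fix_'P[s] by apply: (afix_mulg psi_skew).
have cent1_xy : x * y \in 'C_C[k].
  by apply: (subsetP (afix_rotations nt_s)); rewrite inE Fxy (mul_reflections dihC).
have: x * y \in [1] by rewrite (subsetP tiFC) // in_setI Fxy.
by rewrite inE -eq_invg_mul (reflection_inv dihC Cx) => /eqP.
Qed.

Lemma afix_reflection_fixed s y :
  s \in <[psi]>^# -> 'Fix_'P[s] :&: 'C_C[k] \subset [1] ->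
  y \in 'Fix_'P[s] -> y \notin C -> psi y = y.
Proof.
move=> nt_s tiFC sy Cy; have /setD1P[_ psi_s] := nt_s.
have spy : psi y \in 'Fix_'P[s] := afix_invariant psi_s psi_cycle sy.
apply: (afix_reflection_unique nt_s tiFC) => //; apply/negP=> Cpy.
have: psi y \in [1].
  by rewrite (subsetP tiFC) // in_setI spy (subsetP (afix_rotations nt_s)) // inE spy.
by rewrite inE -psi1 (inj_eq perm_inj) (negPf (reflection_neq1 Cy)).
Qed.

Lemma afix_outside_dihedral_orbit y : y \notin X ->
  exists2 s, s \in <[psi]>^# & y \in 'Fix_'P[s].
Proof.
apply: (afix_outside_orbit psi_skew X_orbit).
by rewrite (card_dihedral_rotations dihC) ltn_double card_rotations_lt_orbit.
Qed.

Lemma perm_ker_sqr : psi k ^+ 2 = 1.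
Proof. by rewrite expg2 -(skew_kerP _ psi1 ker_k_id) -expg2 kk. Qed.

Lemma orbit_involution_image x w : x \in X -> x ^+ 2 = 1 -> w \in <[psi]> ->
  w \notin cocycle psi @: C -> w x ^+ 2 = 1.
Proof.
move=> Xx xx psi_w; apply: contraNeq => wxx.
have: w x \in X :\: 'Ldiv_2() by rewrite !inE wxx (generating_orbit_perm X_orbit).
rewrite -(cocycle_noninvolutions Xx xx).1 => /imsetP[c /setDP[Cc _]].
move/(generating_orbit_inj psi_skew X_orbit Xx psi_w (cocycle_in c))->.
exact: imset_f.
Qed.

(* An element w of <[psi]> that is not of the form cocycle psi g maps the
   involutions k and psi k of X to involutions, so w k and psi (w k) are
   involutions and w k lies in the kernel. *)
Lemma card_orbit_mem_ker : k \in X -> #|X| = #|C|.+1.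
Proof.
move=> Xk; apply/eqP; rewrite eqn_leq card_rotations_lt_orbit andbT.
rewrite (card_generating_orbit psi_skew X_orbit) orderE.
rewrite -(card_in_imset (cocycle_inj_in skew_ker_rotations)) -add1n
  -(cards1 (1 : {perm gT})).
apply: leq_trans (leq_card_setU _ _); apply: subset_leq_card; apply/subsetP=> w psi_w.
rewrite in_setU; apply: contraT; rewrite negb_or in_set1 => /andP[/eqP w_neq1 cw].
case: w_neq1; apply: (generating_orbit_semiregular psi_skew X_orbit psi_w Xk).
have Xwk : w k \in X by rewrite (generating_orbit_perm X_orbit).
have: w k \in skew_ker psi.
  apply: (consecutive_involutions psi_skew X_orbit) => //;
    first exact: orbit_involution_image.
  rewrite -(cycle_permC _ psi_w) // orbit_involution_image ?perm_ker_sqr //.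
  by rewrite (generating_orbit_perm X_orbit).
by rewrite ker_k => /set2P[/eqP|//]; rewrite (negPf (generating_orbit_neq1 Xwk)).
Qed.

Lemma card_outside_reflections : #|C| = (#|X :\: C| + #|~: C :\: X|)%N.
Proof. by rewrite -(card_reflections dihC) -(cardsID X (~: C)) setIC -setDE. Qed.

Let psi_nt : psi \in <[psi]>^#. Proof. by rewrite in_setD1 skew_perm_neq1. Qed.

Section OddOrder.

Hypothesis cent1_triv : 'C_C[k] = 1.

Let afix_cent1_TI s : 'Fix_'P[s] :&: 'C_C[k] \subset [1].
Proof. by rewrite cent1_triv subsetIr. Qed.

Lemma outside_reflection_fixed_odd y : y \in ~: C :\: X -> psi y = y.
Proof.
rewrite !inE => /andP[Xy Cy]; have [s nt_s sy] := afix_outside_dihedral_orbit Xy.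
exact: afix_reflection_fixed nt_s (afix_cent1_TI s) sy Cy.
Qed.

Lemma card_outside_reflections_odd : (#|~: C :\: X| <= 1)%N.
Proof.
apply/card_le1_eqP=> x y outx outy;
  apply: (afix_reflection_unique psi_nt (afix_cent1_TI psi)).
- by apply/afix_permP; apply: outside_reflection_fixed_odd.
- by apply/afix_permP; apply: outside_reflection_fixed_odd.
- by case/setDP: outy => /setCP/negP.
by case/setDP: outx => /setCP/negP.
Qed.

Lemma ker_mem_orbit_odd : k \in X.
Proof.
apply: contraT => Xk; have outk : k \in ~: C :\: X by rewrite !inE Xk.
have [c Cc c_neq1] : exists2 c, c \in C & c != 1.
  by apply/trivgPn; rewrite trivg_card1 gtn_eqF.
have mem_C d : d \in C -> d != 1 -> (d \in X) && (k * d \in X).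
  move=> Cd d_neq1; rewrite mem_orbit_rotation // cent1_triv inE d_neq1 /=.
  apply: contraT => Xkd.
  have outkd : k * d \in ~: C :\: X by rewrite !inE Xkd groupMr.
  have /eqP := card_le1_eqP card_outside_reflections_odd _ _ outk outkd.
  by rewrite -{2}[k]mulg1 (inj_eq (mulgI k)) (negPf d_neq1).
have cc_neq1 : c ^+ 2 != 1.
  apply: contra c_neq1 => /eqP cc; have: c \in 'C_C[k].
    by rewrite (cent1_reflection dihC Ck); apply/LdivP.
  by rewrite cent1_triv inE.
have /andP[Xc Xkc] := mem_C c Cc c_neq1.
have /andP[Xcc Xkcc] := mem_C _ (groupX 2 Cc) cc_neq1.
have := fixed_skew_ker_involution psi_skew X_orbit c ker_k_id
  (order_reflection dihC Ck).
by move/(_ (outside_reflection_fixed_odd outk)); rewrite Xc Xkc Xcc Xkcc.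
Qed.

Lemma card_rotations_odd : #|C| = 3.
Proof.
have := card_orbit_reflections.
rewrite (card_orbit_mem_ker ker_mem_orbit_odd) cent1_triv cards1.
have := odd_cent1_reflection dihC Ck cent1_triv; have := card_outside_reflections.
move: C_gt1 card_outside_reflections_odd; lia.
Qed.

End OddOrder.

Section EvenOrder.

Variable z : gT.
Hypothesis oz : #[z] = 2.
Hypothesis cent1_z : 'C_C[k] = <[z]>.

Let mem_cent1 g : (g \in 'C_C[k]) = (g == 1) || (g == z).
Proof. by rewrite cent1_z cycle2g // !inE. Qed.

Let z_neq1 : z != 1. Proof. by rewrite -order_gt1 oz. Qed.
Let Cz : z \in C.
Proof. by have := mem_cent1 z; rewrite eqxx orbT inE => /andP[]. Qed.
Let zC : z \in 'Z([set: gT]).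
Proof. by rewrite (central_rotation dihC Cz) // -oz expg_order. Qed.

Lemma perm_cent1_neq : psi z != z.
Proof.
apply/eqP=> psiz; have: z \in skew_ker psi :&: C.
  by rewrite inE Cz andbT; apply: central_fixed_skew_ker.
by rewrite skew_ker_rotations inE (negPf z_neq1).
Qed.

Lemma outside_cent1_fixed : exists2 s, s \in <[psi]>^# & z \in 'Fix_'P[s].
Proof.
apply: afix_outside_dihedral_orbit.
by rewrite mem_orbit_rotation // mem_cent1 eqxx orbT.
Qed.

Lemma perm_cent1_reflection : psi z \notin C.
Proof.
have [s nt_s sz] := outside_cent1_fixed; have /setD1P[_ psi_s] := nt_s.
apply/negP=> Cpz; have: psi z \in 'C_C[k].
  by rewrite (subsetP (afix_rotations nt_s)) // inE Cpz andbT (afix_invariant psi_s).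
by rewrite mem_cent1 (negPf perm_cent1_neq) orbF -psi1 (inj_eq perm_inj)
  (negPf z_neq1).
Qed.

Let afix_cent1_TI s : z \notin 'Fix_'P[s] -> 'Fix_'P[s] :&: 'C_C[k] \subset [1].
Proof.
move=> sz; apply/subsetP=> g /setIP[sg]; rewrite mem_cent1 inE => /orP[//|/eqP gz].
by rewrite -gz sg in sz.
Qed.

Lemma outside_reflection_fixed_even y :
  y \in ~: C :\: X -> y \notin [set psi z; psi z * z] -> psi y = y.
Proof.
rewrite !inE => /andP[Xy Cy]; rewrite negb_or => /andP[/eqP y_neq /eqP y_neqz].
have [s nt_s sy] := afix_outside_dihedral_orbit Xy; have /setD1P[_ psi_s] := nt_s.
apply: (afix_reflection_fixed nt_s _ sy Cy); apply: afix_cent1_TI; apply/negP=> sz.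
have Cpz := perm_cent1_reflection; have spz := afix_invariant psi_s psi_cycle sz.
have: psi z * y \in 'C_C[k].
  rewrite (subsetP (afix_rotations nt_s)) // inE (mul_reflections dihC Cpz Cy) andbT.
  exact: (afix_mulg psi_skew).
rewrite mem_cent1 => /orP[]/eqP; last first.
  by move/(canRL (mulKg _)); rewrite (reflection_inv dihC Cpz).
by move/(canRL (mulKg _)); rewrite (reflection_inv dihC Cpz) mulg1.
Qed.

Lemma card_outside_reflections_even : (#|~: C :\: X| <= 3)%N.
Proof.
rewrite -(cardsID [set psi z; psi z * z]) -[3]/(2 + 1)%N leq_add //.
  apply: leq_trans (subset_leq_card (subsetIr _ _)) _.
  by rewrite cards2; case: (_ != _).
apply/card_le1_eqP=> x y /setDP[outx x_neq] /setDP[outy y_neq].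
apply: (afix_reflection_unique psi_nt (afix_cent1_TI _)).
- by apply/afix_permP/eqP; apply: perm_cent1_neq.
- by apply/afix_permP; apply: outside_reflection_fixed_even.
- by apply/afix_permP; apply: outside_reflection_fixed_even.
- by case/setDP: outy => /setCP/negP.
by case/setDP: outx => /setCP/negP.
Qed.

(* The bounds leave only #|C| = 6 and #[psi] = 7, so that psi is a power of a
   permutation fixing z. *)
Lemma cent1_ker_neq_involution : False.
Proof.
have order7 : #[psi] = 7.
  rewrite -(card_generating_orbit psi_skew X_orbit).
  have := card_orbit_reflections; have := card_orbit_reflections_cent1.
  have := card_rotations_lt_orbit.
  have := card_outside_reflections; have := card_outside_reflections_even.
  rewrite cent1_z -orderE oz; lia.
have [s nt_s sz] := outside_cent1_fixed; case/eqP: perm_cent1_neq.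
by apply: (@afix_perm_cycle _ s); rewrite // -(nt_gen_prime _ nt_s) // -orderE order7.
Qed.

End EvenOrder.

Lemma cent1_ker_trivial : 'C_C[k] = 1.
Proof.
have := dvdn_card_cent1_reflection dihC Ck; rewrite dvdn_divisors // !inE.
case/orP=> /eqP card_cent1; first by apply/eqP; rewrite trivg_card1 card_cent1.
have [cycC _ _] := dihC.
have /cyclicP[z cent1_z] : cyclic 'C_C[k] := cyclicS (subsetIl _ _) cycC.
by case: (cent1_ker_neq_involution _ cent1_z); rewrite orderE -cent1_z.
Qed.

Lemma ker_mem_orbit : k \in X.
Proof. exact: ker_mem_orbit_odd cent1_ker_trivial. Qed.

Lemma card_rotations : #|C| = 3.
Proof. exact: card_rotations_odd cent1_ker_trivial. Qed.

Lemma card_orbit4 : #|X| = 4.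
Proof. by rewrite (card_orbit_mem_ker ker_mem_orbit) card_rotations. Qed.

Lemma perm_ker_neq i : (0 < i < 4)%N -> (psi ^+ i) k != k.
Proof.
rewrite -card_orbit4.
exact: (generating_orbit_free psi_skew X_orbit ker_mem_orbit).
Qed.

Lemma orbit_reflections : X :\: C = [set k; psi k].
Proof.
have Xpk : psi k \in X by rewrite (generating_orbit_perm X_orbit) ?ker_mem_orbit.
have Cpk : psi k \notin C.
  by have /imsetP[c Cc ->] := orbit_involution_conj Xpk perm_ker_sqr; rewrite groupJr.
apply/esym/eqP; rewrite eqEcard; apply/andP; split.
  by apply/subsetP=> x /set2P[]->; rewrite inE ?Ck ?ker_mem_orbit ?Cpk ?Xpk.
have := card_orbit_reflections; rewrite cent1_ker_trivial cards1 card_orbit4.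
rewrite card_rotations cards2 eq_sym (perm_ker_neq (i := 1) isT); lia.
Qed.

Lemma perm_ker_rotation i : (1 < i < 4)%N -> (psi ^+ i) k \in C :\ 1.
Proof.
case/andP=> i_gt1 i_lt4; have Xik : (psi ^+ i) k \in X.
  by rewrite (generating_orbit_perm X_orbit) ?mem_cycle ?ker_mem_orbit.
rewrite in_setD1 generating_orbit_neq1 //=; apply: contraT => Cik.
have: (psi ^+ i) k \in [set k; psi k] by rewrite -orbit_reflections inE Cik.
case/set2P=> /eqP; first by rewrite (negPf (perm_ker_neq _)) // (ltnW i_gt1).
rewrite -(ltn_predK i_gt1) expgSr permM (inj_eq perm_inj) (negPf (perm_ker_neq _)) //.
by move: i_gt1 i_lt4; lia.
Qed.

Let u := psi (psi k).

Let uC : u \in C :\ 1. Proof. by have := @perm_ker_rotation 2 isT; rewrite permX. Qed.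

Lemma order_perm2_ker : #[u] = 3.
Proof.
have /setD1P[u_neq1 Cu] := uC; apply: nt_prime_order u_neq1 => //; apply/eqP.
by rewrite -order_dvdn -card_rotations; apply: order_dvdG.
Qed.

Lemma rotations_perm2_ker : C :=: <[u]>.
Proof.
have /setD1P[_ Cu] := uC.
by apply/esym/eqP; rewrite eqEcard cycle_subG Cu card_rotations -orderE
  order_perm2_ker.
Qed.

Lemma perm3_ker : psi u = u^-1.
Proof.
have /setD1P[u_neq1 _] := uC.
have /setD1P[v_neq1] : psi u \in C :\ 1.
  by have := @perm_ker_rotation 3 isT; rewrite permX.
rewrite rotations_perm2_ker mem_cycle3g ?order_perm2_ker // (negPf v_neq1) /=.
rewrite !(inj_eq perm_inj) (negPf (perm_ker_neq (i := 1) isT)) /=.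
by move/eqP.
Qed.

Lemma perm4_ker : psi u^-1 = k.
Proof.
have <- : (psi ^+ 4) k = k.
  by rewrite -card_orbit4 (card_generating_orbit psi_skew X_orbit) expg_order perm1.
by rewrite -perm3_ker permX.
Qed.

Lemma perm_ker : psi k = k * u^-1.
Proof.
have /setDP[_ Ct] : psi k \in X :\: C by rewrite orbit_reflections !inE eqxx orbT.
have /setD1P[_ Cu] := uC; have := mul_reflections dihC Ck Ct.
rewrite rotations_perm2_ker mem_cycle3g ?order_perm2_ker // !(canF_eq (mulKg k)).
rewrite (reflection_inv dihC Ck) mulg1 (negPf (perm_ker_neq (i := 1) isT)) /=.
case/pred2P=> // psi_k; have: psi (psi k) \in C by [].
by rewrite psi_k (skew_kerP _ psi1 ker_k_id) -/u perm3_ker groupMr ?groupV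
  ?(negPf Ct).
Qed.

Lemma orbit_rotations : X :&: C = [set u; u^-1].
Proof.
have /setD1P[u_neq1 _] := uC; apply/setP=> x.
rewrite in_setI andbC (andb_id2l (@mem_orbit_rotation x)) cent1_ker_trivial.
rewrite rotations_perm2_ker mem_cycle3g ?order_perm2_ker // !inE.
have [->|_] := eqVneq x 1; last by rewrite andbT.
by rewrite andbF ![1 == _]eq_sym eq_invg1 (negPf u_neq1).
Qed.

Lemma skew_ker_octahedral :
  exists u, [/\ #[u] = 3, C :=: <[u]> & octahedral_cycle psi X k u].
Proof.
exists u; split; [exact: order_perm2_ker | exact: rotations_perm2_ker | split].
- rewrite -[LHS](setID X C) orbit_rotations orbit_reflections setUC.
  by rewrite perm_ker !setUA.
- exact: perm_ker.
- by rewrite -perm_ker.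
- exact: perm3_ker.
exact: perm4_ker.
Qed.

End TwoElementKernel.

Section KernelInRotations.

Hypothesis ker_C : skew_ker psi \subset C.

Let ker_psiM k g : k \in skew_ker psi -> psi (k * g) = psi k * psi g.
Proof. by move=> Kk; apply: (skew_kerP k psi1). Qed.

Lemma consecutive_reflection x : x \in X -> x \notin C -> psi x \in C.
Proof.
move=> Xx Cx; apply: contraT => Cpx; case/negP: (Cx); apply: (subsetP ker_C).
by apply: (consecutive_involutions psi_skew X_orbit) => //;
  apply: (reflection_sqr dihC).
Qed.

(* Otherwise a is the central involution. As cocycle psi (psi^-1 a) sends a to
   psi a, an element s != 1 of <[psi]> fixes a, hence also all conjugates of the
   reflection psi a; the group they generate has at least #|C| elements, none of
   them in X, whereas #|X| > #|C|. *)
Lemma perm_generator_rotation a : skew_ker psi = <[a]> -> psi a \in C.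
Proof.
move=> ker_a; have Ka : a \in skew_ker psi by rewrite ker_a cycle_id.
have Ca : a \in C := subsetP ker_C a Ka.
apply: contraT => Cpa.
have a_neq1 : a != 1 by apply: contraNneq Cpa => ->; rewrite psi1.
have aa : a ^+ 2 = 1.
  apply: (@perm_inj _ psi); rewrite expg2 ker_psiM // psi1.
  by rewrite -expg2 (reflection_sqr dihC Cpa).
have oa : #[a] = 2 by apply: nt_prime_order.
have aZ := central_rotation dihC Ca aa.
have [s nt_s sa] : exists2 s, s \in <[psi]>^# & a \in 'Fix_'P[s].
  apply: central_skew_ker_afix => //; rewrite ker_a cycle2g // !inE.
  apply/norP; split; apply: contraNneq Cpa => /(canRL (permK _)); rewrite invgK.
    by rewrite psi1 => a1; rewrite a1 eqxx in a_neq1.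
  by move <-.
have /setD1P[_ psi_s] := nt_s; pose F := Group (afix_group_set psi_skew psi_s).
have le_CF : (#|C| <= #|F|)%N.
  apply: (card_conj_closed dihC Cpa) => [|c Cc];
    first exact: afix_invariant psi_s psi_cycle sa.
  exact: afix_conj.
have lt_CX : (#|C| < #|X|)%N.
  have <- : #|[set: gT] : skew_ker psi| = #|C|; last exact: index_skew_ker_lt_orbit.
  apply/eqP; rewrite -(eqn_pmul2l (isT : 0 < 2)%N) -{1}oa orderE -ker_a.
  by rewrite (Lagrange (subsetT _)) cardsT (card_dihedral_rotations dihC) mul2n.
have dis := afix_generating_orbit psi_skew X_orbit nt_s.
have: (#|F| + #|X| <= #|gT|)%N.
  by rewrite -cardsUI (disjoint_setI0 dis) cards0 addn0 max_card.
by rewrite (card_dihedral_rotations dihC) -addnn leqNgt -addnS leq_add.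
Qed.

Lemma skew_ker_invariant : {in skew_ker psi, forall k, psi k \in skew_ker psi}.
Proof.
have [cycC _ _] := dihC; have /cyclicP[a ker_a] := cyclicS ker_C cycC.
have Ka : a \in skew_ker psi by rewrite ker_a cycle_id.
have psiX i : psi (a ^+ i) = psi a ^+ i.
  by elim: i => [|i IHi]; rewrite ?expg0 // !expgS ker_psiM // IHi.
have eq_a : <[psi a]> = <[a]>.
  apply/eqP; rewrite (eq_subG_cyclic cycC) ?cycle_subG ?perm_generator_rotation //.
    rewrite -!orderE eqn_dvd !order_dvdn -psiX expg_order psi1 eqxx /=.
    by apply/eqP/(@perm_inj _ psi); rewrite psiX expg_order psi1.
  exact: (subsetP ker_C).
by move=> k; rewrite ker_a => /cycleP[i ->]; rewrite psiX -eq_a mem_cycle.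
Qed.

Lemma skew_ker_proper : skew_ker psi \proper C.
Proof.
rewrite properEneq ker_C andbT; apply/eqP=> defC.
have [x Xx Cx] := exists_orbit_reflection; case/negP: (Cx).
rewrite -defC -(permK psi x) (skew_ker_cycle skew_ker_invariant) ?groupV //.
by rewrite defC consecutive_reflection.
Qed.

Lemma skew_ker_normal : skew_ker psi <| [set: gT].
Proof.
rewrite /normal subsetT; apply/subsetP=> g _; rewrite inE;
  apply/subsetP=> _ /imsetP[k Kk ->].
have Ck := subsetP ker_C k Kk; have [cycC _ _] := dihC.
have [Cg|Cg] := boolP (g \in C); last by rewrite (conj_rotation dihC) ?groupV.
by rewrite conjgE (centsP (cyclic_abelian cycC) k Ck g Cg) mulKg.
Qed.

(* s is an automorphism of the group, and psi = cocycle psi (g * g) = psi * s * s. *)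
Lemma coset_fixing_involution s g : s \in <[psi]> ->
  (forall h, s h * h^-1 \in skew_ker psi) ->
  g \notin C -> cocycle psi g = psi * s -> s ^+ 2 = 1.
Proof.
move=> psi_s fix_coset Cg cocycle_g; have [x Xx Cx] := exists_orbit_reflection.
have Csx : s x \notin C.
  by apply: contra Cx => Csx; rewrite -groupV -(groupMl _ Csx) (subsetP ker_C).
have s_aut : skew_ker s = [set: gT].
  apply: (skew_ker_coset_fixing psi_skew X_orbit _ psi_s fix_coset Xx).
    exact: skew_ker_invariant.
  by apply: (consecutive_involutions psi_skew X_orbit psi_s Xx);
    apply: (reflection_sqr dihC).
have cocycle_s h : cocycle s h = s.
  apply/eqP; rewrite -mem_skew_ker ?s_aut ?inE //; exact: skew_perm1 psi_s.
apply: (mulgI psi); rewrite mulg1 -{2}(cocycleg1 psi1) -(reflection_sqr dihC Cg).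
by rewrite expg2 cocycleM cocycle_g cocycle_permM cocycle_g cocycle_s mulgA.
Qed.

End KernelInRotations.

End DihedralOrbit.

(** * Quotient by the kernel *)

Section InducedPerm.

Variables (gT : finGroupType) (N : {group gT}).
Implicit Types (g h k x : gT) (X : {set gT}) (C : {group gT}).
Hypothesis normalN : N <| [set: gT].

Let in_norm g : g \in 'N(N).
Proof. exact: (subsetP (normal_norm normalN)). Qed.

Let cosetM g h : coset N (g * h) = coset N g * coset N h.
Proof. exact: coset_morphM. Qed.

Lemma induced_perm_exists (psi : {perm gT}) :
    (forall k g, k \in N -> coset N (psi (k * g)) = coset N (psi g)) ->
  exists psib : {perm coset_of N}, forall g, psib (coset N g) = coset N (psi g).
Proof.
move=> psiN; pose f (xb : coset_of N) := coset N (psi (repr xb)).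
have fE g : f (coset N g) = coset N (psi g).
  have [//|//|k Nk repr_g] := kercoset_rcoset _ _ (coset_reprK (coset N g)).
  by rewrite /f repr_g psiN.
have fK : cancel (fun xb : coset_of N => coset N (psi^-1 (repr xb))) f.
  by move=> xb; rewrite fE permKV coset_reprK.
by exists (perm (can_inj (canF_sym fK))) => g; rewrite permE fE.
Qed.

Lemma mem_quotient_coset C g : N \subset C -> (coset N g \in C / N) = (g \in C).
Proof.
move=> sNC; apply/idP/idP=> [/morphimP[c Nc Cc]|]; last exact: mem_quotient.
by case/kercoset_rcoset=> // k Nk ->; rewrite groupMr // (subsetP sNC).
Qed.

Lemma card_coset_of : #|{: coset_of N}| = #|[set: gT] : N|.
Proof. by rewrite -card_quotient ?normal_norm // quotientT cardsT. Qed.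

Lemma quotient_dihedral_rotations C :
  N \subset C -> dihedral_rotations C -> dihedral_rotations (C / N)%G.
Proof.
move=> sNC dihC; have [cycC iC _] := dihC; split.
- exact: quotient_cyclic.
- rewrite /= -(quotientT N) index_quotient_eq ?normal_norm ?subsetT //.
  by rewrite subIset ?sNC ?orbT.
move=> xb; have [g _ ->] := cosetP xb; rewrite mem_quotient_coset // => Cg.
by rewrite expg2 -cosetM -expg2 (reflection_sqr dihC Cg) coset_id.
Qed.

Variables (psi : {perm gT}) (psib : {perm coset_of N}).
Hypothesis psibE : forall g, psib (coset N g) = coset N (psi g).

Lemma induced_permX i g : (psib ^+ i) (coset N g) = coset N ((psi ^+ i) g).
Proof.
elim: i => [|i IHi]; first by rewrite !perm1.
by rewrite !expgSr !permM IHi psibE.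
Qed.

Lemma induced_cocycle g h :
  cocycle psib (coset N g) (coset N h) = coset N (cocycle psi g h).
Proof.
rewrite !cocycleE -cosetM !psibE cosetM; congr (_ * _).
by rewrite (morphV (coset_morphism N)).
Qed.

Lemma induced_skew_perm : skew_perm psi -> skew_perm psib.
Proof.
case=> psi1 cocycle_psi; split; first by rewrite -(coset_id (group1 N)) psibE psi1.
move=> gb; have [g _ ->] := cosetP gb; have /cycleP[i cocycle_g] := cocycle_psi g.
apply/cycleP; exists i; apply/permP=> hb; have [h _ ->] := cosetP hb.
by rewrite induced_cocycle induced_permX cocycle_g.
Qed.

Lemma induced_generating_orbit X : generating_orbit psi X ->
  generating_orbit psib (X / N).
Proof.
move=> X_orbit; have [X_gen /imsetP[x _ def_X]] := X_orbit; split.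
  by rewrite -quotient_gen ?X_gen ?quotientT // (subset_trans (subsetT X))
    ?normal_norm.
apply/imsetP; exists (coset N x) => //; rewrite def_X; apply/setP=> yb.
apply/morphimP/porbitP=> [[_ _ /porbitP[i ->] ->] | [i ->]].
  by exists i; rewrite induced_permX.
by exists ((psi ^+ i) x); rewrite ?mem_porbit ?induced_permX.
Qed.

End InducedPerm.

Section QuotientByKernel.

Variables (gT : finGroupType) (C : {group gT}) (psi : {perm gT}) (X : {set gT}).
Implicit Types (g h x y : gT) (s : {perm gT}).
Hypothesis dihC : dihedral_rotations C.
Hypothesis C_gt1 : (1 < #|C|)%N.
Hypothesis psi_skew : skew_perm psi.
Hypothesis X_orbit : generating_orbit psi X.
Hypothesis ker_C : skew_ker psi \subset C.

Let K := [group of skew_ker psi].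
Let psi1 : psi 1 = 1. Proof. by case: psi_skew. Qed.
Let normalK : K <| [set: gT]. Proof. exact: (skew_ker_normal dihC ker_C). Qed.
Let in_norm g : g \in 'N(K).
Proof. exact: (subsetP (normal_norm normalK)). Qed.

Lemma quotient_ker_perm_exists :
  exists psib : {perm coset_of K}, forall g, psib (coset K g) = coset K (psi g).
Proof.
apply: induced_perm_exists => // k g Kk.
rewrite (skew_kerP _ psi1 Kk) coset_kerl //.
exact: (skew_ker_invariant dihC C_gt1 psi_skew X_orbit ker_C).
Qed.

Lemma card_quotient_ker_gt1 : (1 < #|C / K|)%N.
Proof.
rewrite card_quotient ?(subset_trans (subsetT C)) ?normal_norm // indexg_gt1.
by have /andP[] := skew_ker_proper dihC C_gt1 psi_skew X_orbit ker_C.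
Qed.

Variable psib : {perm coset_of K}.
Hypothesis psibE : forall g, psib (coset K g) = coset K (psi g).

Let mem_coset g : (coset K g \in C / K) = (g \in C).
Proof. exact: mem_quotient_coset. Qed.

Let psib_skew : skew_perm psib. Proof. exact: (induced_skew_perm normalK psibE). Qed.
Let dihCK : dihedral_rotations (C / K)%G.
Proof. exact: quotient_dihedral_rotations. Qed.

Lemma quotient_ker_involution g : g \notin C -> coset K g \in skew_ker psib ->
  exists s, [/\ s \in <[psi]>, #[s] = 2 & cocycle psi g = psi * s].
Proof.
have [psib1 _] := psib_skew; have [_ cocycle_psi] := psi_skew.
move=> Cg; rewrite mem_skew_ker // => /eqP cocycle_g.
pose s := psi^-1 * cocycle psi g.
have psi_s : s \in <[psi]> by rewrite groupM ?groupV ?cycle_id.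
have def_s : cocycle psi g = psi * s by rewrite mulKVg.
have fix_coset h : s h * h^-1 \in K.
  have := induced_cocycle normalK psibE g (psi^-1 h).
  rewrite cocycle_g psibE permKV def_s permM permKV => eq_h.
  by have [||k Kk ->] := kercoset_rcoset _ _ (esym eq_h); rewrite ?mulgK.
exists s; split=> //; apply: nt_prime_order => //.
  by apply: (coset_fixing_involution dihC C_gt1 psi_skew X_orbit ker_C) Cg def_s.
apply: contraNneq Cg => s1; apply: (subsetP ker_C); rewrite mem_skew_ker //.
by rewrite def_s s1 mulg1.
Qed.

Lemma quotient_ker_reflection_unique :
  {in skew_ker psib :\: C / K &, forall xb yb, xb = yb}.
Proof.
move=> xb yb; have [x _ ->] := cosetP xb; have [y _ ->] := cosetP yb.
rewrite !in_setD !mem_coset => /andP[Cx Kx] /andP[Cy Ky].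
have [s [psi_s os cocycle_x]] := quotient_ker_involution Cx Kx.
have [w [psi_w ow cocycle_y]] := quotient_ker_involution Cy Ky.
have: cocycle psi x == cocycle psi y.
  rewrite cocycle_x cocycle_y.
  by rewrite (cyclic_involution_unique (cycle_cyclic psi) psi_s psi_w).
by rewrite cocycle_eq => Kxy; rewrite -[x](mulgKV y) coset_kerl.
Qed.

Lemma quotient_skew_kerE gb :
  gb \in skew_ker psib -> gb \notin C / K -> skew_ker psib = [set 1; gb].
Proof.
move=> Kgb Cgb; apply/setP=> xb; apply/idP/set2P=> [Kxb | [] -> //].
have KgbC : gb \in skew_ker psib :\: C / K by rewrite in_setD Cgb.
have [Cxb|Cxb] := boolP (xb \in C / K); last first.
  by right; apply: quotient_ker_reflection_unique; rewrite // in_setD Cxb.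
left; apply: (mulIg gb); rewrite mul1g; apply: quotient_ker_reflection_unique => //.
by rewrite in_setD groupMl // Cgb groupM.
Qed.

(* By skew_ker_octahedral, gb and psib gb would be consecutive elements of X / K,
   both outside C / K, but no two consecutive elements of X are reflections. *)
Lemma quotient_ker_sub_rotations : skew_ker psib \subset C / K.
Proof.
apply/subsetP=> gb Kgb; apply: contraT => Cgb.
have XK_orbit := induced_generating_orbit normalK psibE X_orbit.
have ker_gb := quotient_skew_kerE Kgb Cgb.
have [ub [_ def_CK [def_XK psib_gb _ _ _]]] :=
  skew_ker_octahedral dihCK card_quotient_ker_gt1 psib_skew XK_orbit Cgb ker_gb.
have: gb \in X / K by rewrite def_XK !inE eqxx.
case/morphimP=> x _ Xx def_gb; have Cx : x \notin C by rewrite -mem_coset -def_gb.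
have := consecutive_reflection dihC psi_skew X_orbit ker_C Xx Cx.
rewrite -mem_coset -psibE -def_gb psib_gb groupMr ?(negPf Cgb) //.
by rewrite groupV /= def_CK cycle_id.
Qed.

End QuotientByKernel.

Theorem skew_ker_reflection (gT : finGroupType) (C : {group gT})
    (psi : {perm gT}) (X : {set gT}) :
  dihedral_rotations C -> (1 < #|C|)%N -> skew_perm psi -> generating_orbit psi X ->
  ~~ (skew_ker psi \subset C).
Proof.
have [n] := ubnP #|gT|; elim: n gT C psi X => // n IHn gT C psi X lt_n.
move=> dihC C_gt1 psi_skew X_orbit; apply/negP=> ker_C.
have [psib psibE] := quotient_ker_perm_exists dihC C_gt1 psi_skew X_orbit ker_C.
have normalK := skew_ker_normal dihC ker_C.
have := quotient_ker_sub_rotations dihC C_gt1 psi_skew X_orbit ker_C psibE.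
apply/negP; apply: (IHn _ (C / skew_ker psi)%G _ (X / skew_ker psi)).
- rewrite -ltnS (leq_trans _ lt_n) // ltnS card_coset_of //.
  apply: leq_trans (max_card (mem X)).
  exact: index_skew_ker_lt_orbit dihC C_gt1 psi_skew X_orbit.
- exact: quotient_dihedral_rotations.
- exact: card_quotient_ker_gt1 dihC C_gt1 psi_skew X_orbit ker_C.
- exact: induced_skew_perm psi_skew.
exact: induced_generating_orbit X_orbit.
Qed.

(** * Presentations of dihedral groups *)

Lemma dihedral_relationE (gT : finGroupType) (a b : gT) :
  b ^+ 2 = 1 -> (b * a * b * a == 1) = (a ^ b == a^-1).
Proof.
move=> bb; have bV : b^-1 = b by apply/eqP; rewrite eq_invg_mul -expg2 bb.
by rewrite [RHS]eq_mulgV1 invgK conjgE bV !mulgA.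
Qed.

Section DihedralPresentation.

Variable gT : finGroupType.
Implicit Types a b : gT.

Lemma dihedral_generators_rotations a b :
  b ^+ 2 = 1 -> a ^ b = a^-1 -> <<[set a; b]>> = [set: gT] -> b \notin <[a]> ->
  dihedral_rotations <[a]>%G.
Proof.
move=> bb ab gen_ab b_notin; have ob : #[b] = 2.
  by apply: nt_prime_order => //; apply: contraNneq b_notin => ->; apply: group1.
have defG : <[a]> * <[b]> = [set: gT].
  rewrite -norm_joinEr; first by rewrite joing_idl joing_idr.
  by rewrite cycle_subG inE -cycleJ ab cycleV.
split; first exact: cycle_cyclic.
  have tiAB : <[a]> :&: <[b]> = 1.
    by rewrite setIC; apply: prime_TIg; rewrite -?orderE ?ob ?cycle_subG.
  have /eqP := TI_cardMg tiAB.
  rewrite defG -(Lagrange (subsetT <[a]>)) -[#|<[b]>|]orderE ob.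
  by rewrite eqn_pmul2l // => /eqP.
move=> x; have: x \in <[a]> * <[b]> by rewrite defG inE.
case/mulsgP=> _ y /cycleP[i ->]; rewrite cycle2g // => /set2P[]-> ->.
  by rewrite mulg1 mem_cycle.
have bV : b^-1 = b by apply/eqP; rewrite eq_invg_mul -expg2 bb.
move=> _; have abi : (a ^+ i) ^ b = a ^- i by rewrite conjXg ab expVgn.
by rewrite expg2 -mulgA [b * _]mulgA -{1}bV -mulgA -conjgE abi mulgV.
Qed.

Lemma card_dihedral_presentation n a b :
  (1 < n)%N -> dihedral_presentation n a b -> #|gT| = n.*2.
Proof.
move=> n_gt1 [an bb baba gen_ab isoG]; rewrite -cardsT -(card_dihedral n_gt1).
have genY : <[a]> <*> <[b]> = [set: gT] by rewrite joing_idl joing_idr -gen_ab.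
apply/eqP; rewrite eqn_dvd; apply/andP; split; apply: card_homg.
  rewrite (Grp_dihedral n_gt1); apply/existsP; exists (a, b).
  by rewrite /= !xpair_eqE genY an bb -dihedral_relationE // baba !eqxx.
rewrite isoG.
have /existsP[[x y] /= /eqP[gen_xy xn yy xy]] := isoGrp_hom (Grp_dihedral n_gt1).
apply/existsP; exists (x, y); rewrite /= !xpair_eqE gen_xy xn yy !eqxx /=.
by rewrite dihedral_relationE // xy.
Qed.

Lemma dihedral_presentation_rotations n a b :
  (1 < n)%N -> dihedral_presentation n a b ->
  dihedral_rotations <[a]>%G /\ #|<[a]>| = n.
Proof.
move=> n_gt1 hD; have cardG := card_dihedral_presentation n_gt1 hD.
have [an bb baba gen_ab _] := hD.
have dihA : dihedral_rotations <[a]>%G.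
  apply: (dihedral_generators_rotations bb _ gen_ab).
    by apply/eqP; rewrite -dihedral_relationE // baba.
  apply/negP=> a_b; have: [set: gT] \subset <[a]>.
    rewrite -gen_ab gen_subG; apply/subsetP=> x /set2P[]-> //; exact: cycle_id.
  move/subset_leq_card; rewrite cardsT cardG -orderE.
  have: (#[a] <= n)%N by rewrite dvdn_leq ?order_dvdn ?an // (ltnW n_gt1).
  lia.
by split=> //; apply: double_inj; rewrite -cardG (card_dihedral_rotations dihA).
Qed.

End DihedralPresentation.

(** * Cayley maps *)

Section PermOrbits.

Variables (T : finType) (s : {perm T}).

Lemma card_porbits_uniform m :
  (forall x, #|porbit s x| = m) -> (#|porbits s| * m = #|T|)%N.
Proof.
move=> unif; rewrite -[RHS]sum1_card (partition_big_imset (porbit s)) /=.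
rewrite -sum_nat_const; apply: eq_bigr => _ /imsetP[x _ ->].
by rewrite sum1dep_card -(unif x); apply: eq_card => y; rewrite inE eq_porbit_mem.
Qed.

Lemma card_porbits_prime p : prime p -> s ^+ p = 1 -> (forall x, s x != x) ->
  (#|porbits s| * p = #|T|)%N.
Proof.
move=> p_pr sp s_free; apply: card_porbits_uniform => x; apply: (prime_nt_dvdP p_pr).
  apply: contra (s_free x); rewrite porbitE => /eqP/card_orbit1 orbit_x.
  by rewrite -in_set1 -orbit_x -porbitE -{1}[s]expg1 mem_porbit.
apply: dvdn_trans (_ : #[s] %| p); last by rewrite order_dvdn sp.
by rewrite porbitE dvdn_orbit.
Qed.

End PermOrbits.

Section CayleyMapDarts.

Variables (gT : finGroupType) (M : cayley_map gT).
Implicit Types (g x : gT) (d : cm_dart M).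
Local Notation X := (cm_set M).
Local Notation p := (cm_perm M).

Definition dart_label d : gT := (val d).1^-1 * (val d).2.

Lemma dart_label_mem d : dart_label d \in X.
Proof. exact: (valP d). Qed.

Lemma dart_label_neq1 d : dart_label d != 1.
Proof. by apply: contraNneq (cm_not1 M) => <-; apply: dart_label_mem. Qed.

Lemma dart_eq d d' : (val d).1 = (val d').1 -> dart_label d = dart_label d' -> d = d'.
Proof.
move=> eq1; rewrite /dart_label eq1 => /mulgI eq2; apply: val_inj.
by case: (val d) (val d') eq1 eq2 => [? ?] [? ?] /= -> ->.
Qed.

Lemma rot_start d : (val (cm_rot M d)).1 = (val d).1.
Proof. by rewrite permE. Qed.

Lemma rot_label d : dart_label (cm_rot M d) = p (dart_label d).
Proof. by rewrite permE /dart_label /= mulKg. Qed.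

Lemma rev_start d : (val (cm_rev M d)).1 = (val d).1 * dart_label d.
Proof. by rewrite permE /dart_label /= mulKVg. Qed.

Lemma rev_label d : dart_label (cm_rev M d) = (dart_label d)^-1.
Proof. by rewrite permE /dart_label /= invMg invgK. Qed.

Lemma card_cm_dart : #|{: cm_dart M}| = (#|gT| * #|X|)%N.
Proof.
rewrite card_sig -[#|gT|]cardsT -cardsX.
have inj : injective (fun e : gT * gT => (e.1, e.1 * e.2)).
  by move=> [g x] [h y] /= [-> /mulgI->].
rewrite -(card_imset _ inj); apply: eq_card => -[g h]; rewrite inE.
apply/idP/imsetP => [Xgh | [[g' x]]].
  by exists (g, g^-1 * h); rewrite ?inE //= mulKVg.
by rewrite inE /= => /andP[_ Xx] [-> ->]; rewrite /cm_adj /= mulKg.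
Qed.

Lemma card_porbits_rot : (#|porbits (cm_rot M)| * #|X| = #|gT| * #|X|)%N.
Proof.
rewrite -card_cm_dart; apply: card_porbits_uniform => d.
have rotX i : (val ((cm_rot M ^+ i) d)).1 = (val d).1 /\
    dart_label ((cm_rot M ^+ i) d) = (p ^+ i) (dart_label d).
  elim: i => [|i [IHstart IHlabel]]; first by rewrite !perm1.
  by rewrite !expgSr !permM rot_start rot_label IHlabel.
have [_ porbit_p] := cm_cyclic M; rewrite -(porbit_p _ (dart_label_mem d)).
have label_inj : {in porbit (cm_rot M) d &, injective dart_label}.
  move=> _ _ /porbitP[i ->] /porbitP[j ->]; apply: dart_eq.
  by rewrite (rotX i).1 (rotX j).1.
rewrite -(card_in_imset label_inj); apply: eq_card => x.
apply/imsetP/porbitP => [[_ /porbitP[i ->] ->] | [i ->]].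
  by exists i; rewrite (rotX i).2.
by exists ((cm_rot M ^+ i) d); rewrite ?mem_porbit // (rotX i).2.
Qed.

Lemma card_porbits_rev : (#|porbits (cm_rev M)| * 2 = #|gT| * #|X|)%N.
Proof.
rewrite -card_cm_dart; apply: card_porbits_prime => // [|d].
  apply/permP=> d; rewrite expg2 permM perm1.
  by apply: dart_eq; rewrite ?rev_start ?rev_label ?invgK // mulgK.
apply: contra (dart_label_neq1 d) => /eqP/(congr1 (fun e => (val e).1)).
by rewrite rev_start -{2}[(val d).1]mulg1 => /mulgI->.
Qed.

(* The function q maps the label of a dart to that of the next dart of its face. *)
Lemma card_porbits_face3 (q := fun x => p x^-1) :
    {in X, forall x, q (q (q x)) = x /\ x * q x * q (q x) = 1} ->
  (#|porbits (cm_rev M * cm_rot M)| * 3 = #|gT| * #|X|)%N.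
Proof.
move=> q3; rewrite -card_cm_dart; apply: card_porbits_prime => // [|d].
  apply/permP=> d; have [q3_label mul_labels] := q3 _ (dart_label_mem d).
  rewrite permX perm1; apply: dart_eq; rewrite /= !permM.
    rewrite !(rot_start, rev_start, rot_label, rev_label).
    by rewrite -[RHS]mulg1 -mul_labels !mulgA.
  by rewrite !(rot_label, rev_label).
apply: contra (dart_label_neq1 d) => /eqP/(congr1 (fun e => (val e).1)).
by rewrite permM rot_start rev_start -{2}[(val d).1]mulg1 => /mulgI->.
Qed.

End CayleyMapDarts.

Section Octahedron.

Variables (gT : finGroupType) (M : cayley_map gT) (k u : gT).
Implicit Types (x g : gT).
Local Notation X := (cm_set M).
Hypothesis dih_u : dihedral_rotations <[u]>%G.
Hypothesis ou : #[u] = 3.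
Hypothesis Ck : k \notin <[u]>.
Hypothesis M_cycle : octahedral_cycle (cm_perm M) X k u.

Let y := k * u.

Let kV : k^-1 = k. Proof. exact: (reflection_inv dih_u). Qed.
Let kk : k * k = 1. Proof. by rewrite -{1}kV mulVg. Qed.
Let u_neq1 : u != 1. Proof. by rewrite -order_gt1 ou. Qed.
Let Cy : y \notin <[u]>. Proof. by rewrite groupMr ?cycle_id. Qed.

Lemma card_octahedral_group : #|gT| = 6.
Proof. by rewrite (card_dihedral_rotations dih_u) -orderE ou. Qed.

Lemma octahedral_setE : X = ~: [set 1; y].
Proof.
have [def_X _ _ _ _] := M_cycle; have Cu : u \in <[u]> := cycle_id u.
have neq_y x : x \in <[u]> -> x != y by move=> Cx; apply: contraNneq Cy => <-.
apply/setP=> x; apply/idP/idP=> [Xx|].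
  rewrite !inE negb_or (contraTneq _ Xx) => [|->]; last exact: cm_not1.
  move: Xx; rewrite def_X !inE -!orbA => /or4P[]/eqP->; rewrite /y.
  - by rewrite -{1}[k]mulg1 (inj_eq (mulgI k)) eq_sym u_neq1.
  - by rewrite (inj_eq (mulgI k)) eq_invg_mul -expg2 -order_dvdn ou.
  - exact: neq_y.
  by apply: neq_y; rewrite groupV.
rewrite !inE negb_or def_X !inE => /andP[x_neq1 x_neqy].
have [|Cx] := boolP (x \in <[u]>).
  by rewrite mem_cycle3g // (negPf x_neq1) => /= /orP[]/eqP->; rewrite eqxx ?orbT.
have := mul_reflections dih_u Ck Cx.
rewrite mem_cycle3g // !(canF_eq (mulKg k)) kV mulg1.
by rewrite (negPf x_neqy) => /= /orP[]/eqP->; rewrite eqxx ?orbT.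
Qed.

Lemma card_octahedral_set : #|X| = 4.
Proof.
rewrite octahedral_setE cardsCs setCK card_octahedral_group cards2 eq_sym.
by rewrite (reflection_neq1 Cy).
Qed.

Lemma octahedral_spherical : cm_spherical M.
Proof.
have [def_X p_k p_t p_u p_v] := M_cycle.
have tV : (k * u^-1)^-1 = k * u^-1.
  by apply: (reflection_inv dih_u); rewrite groupMr ?groupV ?cycle_id.
have := card_porbits_rot M; have := card_porbits_rev M.
have := @card_porbits_face3 _ M.
rewrite card_octahedral_set card_octahedral_group /cm_spherical.
move=> faces edges vertices.
have {}faces : (#|porbits (cm_rev M * cm_rot M)| * 3 = 6 * 4)%N.
  apply: faces => x; rewrite def_X !inE -!orbA => /or4P[]/eqP->;
    rewrite !(p_k, p_t, p_u, p_v, kV, tV, invgK); split=> //.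
  - by rewrite mulgA kk mul1g mulVg.
  - by rewrite mulgKV kk.
  - by rewrite -mulgA (mulgA k) kk mul1g mulgV.
  by rewrite -expg2 -expgSr expVgn -ou expg_order invg1.
lia.
Qed.

Lemma octahedral_adjacency : exists2 f : gT -> 'I_3 * bool, bijective f &
  forall g h, cm_adj M g h = octahedron_adj (f g) (f h).
Proof.
have yy : y * y = 1 := reflection_sqr dih_u Cy.
pose e (i : 'I_3 * bool) := u ^+ i.1 * y ^+ i.2.
have e_C i : (e i \in <[u]>) = ~~ i.2.
  rewrite groupMl ?mem_cycle //.
  by case: i => i [] /=; [rewrite expg1 (negPf Cy) | rewrite expg0 group1].
have e_inj : injective e.
  move=> [i b] [j c] eq_e; have eq_bc : b = c.
    by apply: negb_inj; rewrite -(e_C (i, b)) -(e_C (j, c)) eq_e.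
  move: eq_e; rewrite /e /= eq_bc => /mulIg/eqP.
  by rewrite eq_expg_mod_order ou !modn_small // => /eqP/val_inj->.
have e_y i : e i * y = e (i.1, ~~ i.2).
  by rewrite /e -mulgA; case: i => i [] /=; rewrite ?expg1 ?yy ?expg0 ?mul1g.
have [f fK eK] : bijective e.
  by apply: inj_card_bij => //;
    rewrite card_octahedral_group card_prod card_ord card_bool.
exists f; first by exists e.
move=> g h; rewrite /cm_adj /= octahedral_setE -[in LHS](eK g) -[in LHS](eK h).
have mul_e x : ((e (f g))^-1 * e (f h) == x) = (e (f h) == e (f g) * x).
  by rewrite -(inj_eq (mulgI (e (f g)))) mulKVg.
rewrite /octahedron_adj /= !inE !mul_e mulg1 e_y !(inj_eq e_inj).
case: (f g) (f h) => i b [j c]; rewrite !xpair_eqE /= -andb_orr eq_sym.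
by case: b c => [] []; rewrite /= ?andbT ?andbF ?orbF.
Qed.

End Octahedron.

Section SkewMorphism.

Variables (gT : finGroupType) (psi : {perm gT}) (pw : gT -> nat).
Hypothesis skew : skew_morphism psi pw.

Lemma skew_morphism_cocycle g : cocycle psi g = psi ^+ pw g.
Proof. by case: skew => _ _ psiM; apply/permP=> h; rewrite cocycleE psiM mulKg. Qed.

Lemma skew_morphism_skew_perm : skew_perm psi.
Proof.
by case: skew => psi1 _ _; split=> // g; rewrite skew_morphism_cocycle mem_cycle.
Qed.

Lemma power_ker_skew_ker : power_ker pw = skew_ker psi.
Proof.
have [psi1 pw_bound _] := skew; apply/setP=> g; rewrite inE mem_skew_ker //.
rewrite skew_morphism_cocycle -{2}[psi]expg1 eq_expg_mod_order.
have /andP[] := pw_bound g; case: (pw g) #[psi] => // i [|r] // _; rewrite ltnS.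
by move=> le_ir; rewrite -[in RHS]addn1 -[1%N in RHS]add0n eqn_modDr !modn_small.
Qed.

End SkewMorphism.

Lemma associated_generating_orbit (gT : finGroupType) (M : cayley_map gT) psi pw :
  [set: gT] :!=: 1 -> associated_skew_morphism M psi pw ->
  generating_orbit psi (cm_set M).
Proof.
move=> ntG [_ psi_p]; have [p_on porbit_p] := cm_cyclic M; split; first exact: cm_gen.
have [X0|[x Xx]] := set_0Vmem (cm_set M).
  by rewrite -(cm_gen M) X0 gen0 eqxx in ntG.
have psiX i : (psi ^+ i) x = (cm_perm M ^+ i) x /\ (psi ^+ i) x \in cm_set M.
  elim: i => [|i [IHp IHX]]; first by rewrite !perm1.
  by rewrite !expgSr !permM -IHp psi_p // perm_closed.
apply/imsetP; exists x => //; rewrite -(porbit_p x Xx); apply/setP=> y.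
by apply/porbitP/porbitP=> -[i ->]; exists i; have [-> _] := psiX i.
Qed.

Lemma skew_ker_lt4 (gT : finGroupType) (C : {group gT}) (psi : {perm gT}) k :
  dihedral_rotations C -> k \in skew_ker psi -> k \notin C ->
  (#|skew_ker psi| < 4)%N -> skew_ker psi = [set 1; k].
Proof.
move=> dihC Kk Ck lt4; have ok := order_reflection dihC Ck.
rewrite -(cycle2g ok); apply/esym/eqP; rewrite eqEcard cycle_subG Kk -orderE ok /=.
have := order_dvdG Kk; rewrite ok /=; move: lt4; case: #|_| => [|[|[|[|]]]] //.
Qed.

Lemma eq_octahedral_cycle (gT : finGroupType) (psi p : {perm gT}) (X : {set gT})
    (k u : gT) :
  {in X, psi =1 p} -> octahedral_cycle psi X k u -> octahedral_cycle p X k u.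
Proof.
move=> psi_p [def_X psi_k psi_t psi_u psi_v].
by split=> //; rewrite -psi_p // def_X !inE eqxx ?orbT.
Qed.

Theorem theorem4p3 (gT : finGroupType) (n : nat) (a b : gT)
    (M : cayley_map gT) (psi : {perm gT}) (pw : gT -> nat)
    (hn : (2 <= n)%N)
    (hD : dihedral_presentation n a b)
    (hM : cm_regular M)
    (hpsi : associated_skew_morphism M psi pw) :
  (group_set (power_ker pw) /\ power_ker pw :&: ([set: gT] :\: <[a]>) != set0) /\
  ((cm_spherical_octahedron M /\ #|power_ker pw| = 2%N) \/
   (4 <= #|power_ker pw|)%N).
Proof.
have [skew psi_p] := hpsi; rewrite (power_ker_skew_ker skew).
have [dih_a card_a] := dihedral_presentation_rotations hn hD.
have a_gt1 : (1 < #|<[a]>|)%N by rewrite card_a.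
have ntG : [set: gT] :!=: 1.
  by rewrite -cardG_gt1 cardsT (card_dihedral_presentation hn hD) -addnn ltn_addl.
have psi_skew := skew_morphism_skew_perm skew.
have X_orbit := associated_generating_orbit ntG hpsi.
have /subsetPn[k Kk Ck] := skew_ker_reflection dih_a a_gt1 psi_skew X_orbit.
split.
  split; first exact: skew_ker_group_set.
  by apply/set0Pn; exists k; rewrite inE Kk inE Ck in_setT.
have [|lt4] := leqP 4 #|skew_ker psi|; [by right | left].
have ker_k := skew_ker_lt4 dih_a Kk Ck lt4.
have [u [ou def_a psi_cycle]] :=
  skew_ker_octahedral dih_a a_gt1 psi_skew X_orbit Ck ker_k.
have p_cycle := eq_octahedral_cycle psi_p psi_cycle.
have dih_u : dihedral_rotations <[u]>%G by rewrite -(group_inj def_a).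
rewrite ker_k cards2 eq_sym (reflection_neq1 Ck); split=> //.
rewrite def_a in Ck; split; first exact: octahedral_spherical dih_u ou Ck p_cycle.
exact: octahedral_adjacency dih_u ou Ck p_cycle.
Qed.
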